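(* Let $X=(x_{ij})_{1\le i\le n,\,1\le j\le N}$ have i.i.d. entries with $x_{11}\overset{d}{=}-x_{11}$, subgaussian of finite norm, i.e., $\mathbb{E}[x_{11}^{2k}]\le(Ck)^k$ for all $k\in\mathbb{N}$ and some $C>0$, and $\mathbb{E}[x_{11}^2]=1$. Let $A=\frac1NXX^T$, and suppose $\lim_{n\to\infty}\frac nN=\gamma\in(0,\infty)$. Then for $p\in\mathbb{N}$, $p=o(n^{1/2})$, and $\gamma_n=\frac nN$, $$\mathbb{E}[\mathrm{tr}(A^p)]=n\,\beta(p,\gamma_n)\cdot\Big(1+O\Big(\frac{p^2}{n}\Big)\Big).$$
   Context: Here $N=N(n)$ and $p=p(n)$, asymptotics are as $n\to\infty$, and for $k\in\mathbb{N}$, $\gamma>0$, $$\beta(k,\gamma)=\int_{a(\gamma)}^{b(\gamma)}x^kf_\gamma(x)\,dx=\sum_{0\le r\le k-1}\frac{1}{r+1}\binom kr\binom{k-1}{r}\gamma^r,$$ with $a(\gamma)=(1-\sqrt\gamma)^2$, $b(\gamma)=(1+\sqrt\gamma)^2$ and $f_\gamma(x)=\frac{\sqrt{(b(\gamma)-x)(x-a(\gamma))}}{2\pi\gamma x}$ on $[a(\gamma),b(\gamma)]$. *)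

(* Defs.v *)
From HB Require Import structures.
From mathcomp Require Import all_boot all_order all_algebra.
From mathcomp Require Import all_classical all_reals all_analysis.

Set Implicit Arguments.
Unset Strict Implicit.
Unset Printing Implicit Defensive.

Import Order.TTheory GRing.Theory Num.Theory.
Import numFieldNormedType.Exports.

Local Open Scope classical_set_scope.
Local Open Scope ring_scope.

Section RandomVariables.
Context d (T : measurableType d) (R : realType) (P : probability T R).

(* Stated for bare functions, so that it applies to the opposite of a random
   variable as well; [P (X @^-1` B)] is [distribution P X B]. *)
Definition eq_law (X Y : T -> R) : Prop :=
  forall B : set R, measurable B -> P (X @^-1` B) = P (Y @^-1` B).

Definition symmetric_law (X : {RV P >-> R}) : Prop :=
  eq_law X (fun w => - X w).

Definition mutually_independent (I : finType) (X : I -> {RV P >-> R}) : Prop :=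
  forall (J : {set I}) (B : I -> set R),
    (forall i, i \in J -> measurable (B i)) ->
    P (\bigcap_(i in [set` J]) (X i @^-1` B i)) =
      (\prod_(i in J) P (X i @^-1` B i))%E.

Definition iid (I : finType) (X : I -> {RV P >-> R}) : Prop :=
  mutually_independent X /\ forall i j, eq_law (X i) (X j).

Definition sample_covariance (n N : nat) (X : 'I_n -> 'I_N -> {RV P >-> R})
    (w : T) : 'M[R]_n :=
  let Xw : 'M[R]_(n, N) := \matrix_(i, j) X i j w in
  N%:R^-1 *: (Xw *m Xw^T).

End RandomVariables.

Section MarchenkoPastur.
Context (R : realType).

Definition mp_left (g : R) : R := (1 - Num.sqrt g) ^+ 2.
Definition mp_right (g : R) : R := (1 + Num.sqrt g) ^+ 2.

(* At [g = 1] the left endpoint is 0, where the density is 0 by the convention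
   [0^-1 = 0]; this is a null set. *)
Definition mp_density (g x : R) : R :=
  Num.sqrt ((mp_right g - x) * (x - mp_left g)) / (2 * pi * g * x).

(* For [0 < k]; when [1 < g] the Marchenko-Pastur law also has an atom at 0,
   which the density omits and which matters only for [k = 0]. *)
Definition mp_moment (k : nat) (g : R) : R :=
  (\int[lebesgue_measure]_(x in `[mp_left g, mp_right g])
     (x ^+ k * mp_density g x))%R.

End MarchenkoPastur.

(* Main.v *)
Require Import Defs.
From HB Require Import structures.
From mathcomp Require Import all_boot all_order all_algebra.
From mathcomp Require Import all_classical all_reals all_analysis.
From mathcomp Require Import measurable_realfun.
From mathcomp Require Import lra ring zify.

(** The trace of [A ^ p] is [N ^- p] times a sum over closed walks of length [2p]
    on the complete bipartite graph whose vertices are the rows and the columns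
    of [X]; a walk contributes the product over the edges of the moment whose
    order is the number of crossings (expectation_trace). By symmetry of the
    entries only walks crossing every edge an even number of times contribute.

    Main term. Follow a Dyck path of length [2p] from a row: an up-step visits a
    fresh vertex, a down-step goes back to the parent. These walks traverse a
    tree, crossing each edge twice, so they weigh 1 by unit variance. If [r]
    up-steps arrive at rows and [c = p - r] at columns there are about
    [n ^ (r + 1) * N ^ c] of them, that is [N ^ p * n * g ^ r] with [g = n / N].
    The sum of [g ^ r] over all Dyck paths is the [p]-th moment of the
    Marchenko-Pastur law (mp_moment_dyck): on the parametrisation
    [x = 1 + g + 2 sqrt g cos t] of the support the density becomes
    [2 / pi * sin t ^ 2 / x], multiplication by [x] acts on the Chebyshev
    polynomials [sin (l t) / sin t] as one step of a Motzkin path, and a Motzkin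
    step is made of two steps of a Dyck path.

    Lower bound (walk_sum_ge_dyck). All contributions are non-negative, and
    avoiding at most [2p + 1] visited vertices at [p] steps costs a factor
    [1 - O(p ^ 2 / n)].

    Upper bound (walk_sum_le_token_sum, occupancy_le). The subgaussian bound gives
    [E x ^ (2k) <= K ^ (k - 1) * (2k - 1)!!], and [(2k - 1)!!] counts the ways to
    pair the [2k] crossings of an edge. A walk with paired crossings follows a
    Dyck path too: the first crossing of a pair is an up-step, the second one a
    down-step. Put a token on the root and on every vertex where an up-step
    arrives, and remove one from every vertex that a down-step leaves. Then the
    vertex where the walk stands, if it has [c] tokens, lies on at most [2c - 1]
    open pairs. Hence, for prescribed arrivals of the up-steps, the choices at the
    down-steps number at most the product of [(2k - 1)!!] over the vertices, [k]
    being the number of tokens ever received. Since the crossed edges connect the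
    visited vertices, the powers of [K] amount to at most [K ^ (k - 1)] for each
    vertex. What is left is a sum over arbitrary maps from the up-steps, and the
    choice of the root, to the vertices, where a vertex hit [k] times weighs
    [K ^ (k - 1) * (2k - 1)!!].
    Conditioning on the fibre of the last up-step shows that the sum for [r + 1]
    arrivals is at most [n * (1 + O(r / n))] times the sum for [r], whence a total
    factor [1 + O(p ^ 2 / n)]. *)

Set Implicit Arguments.
Unset Strict Implicit.
Unset Printing Implicit Defensive.

Import Order.TTheory GRing.Theory Num.Theory.
Import numFieldNormedType.Exports.

Local Open Scope ring_scope.

(** * Updates of a counting function *)

Section Update.
Context {I : eqType}.
Implicit Types (q : I -> nat) (e : I).

Definition add_at q e : I -> nat := fun x => (q x + (x == e))%N.
Definition del_at q e : I -> nat := fun x => (q x - (x == e))%N.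

Lemma add_atC q e e' : add_at (add_at q e) e' = add_at (add_at q e') e.
Proof. by apply: funext => x; rewrite /add_at addnAC. Qed.

Lemma del_atK q e : (0 < q e)%N -> add_at (del_at q e) e = q.
Proof.
move=> qe; apply: funext => x; rewrite /add_at /del_at.
by case: eqVneq => [->|_]; rewrite ?subn0 ?addn0 // subnK.
Qed.

Lemma del_add_at q e e' : (0 < q e)%N ->
  del_at (add_at q e') e = add_at (del_at q e) e'.
Proof.
move=> qe; apply: funext => x; rewrite /add_at /del_at.
by case: (eqVneq x e) => [->|_]; rewrite ?subn0 // addnBAC.
Qed.

End Update.

(** * Dyck paths *)

Section Dyck.
Context {R : realFieldType}.
Implicit Types (L h : nat) (b : bool) (Phi Psi : nat -> nat -> R).

(** Paths are not represented: [Phi] is the weight of a Dyck suffix of length [L]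
    from height [h] as a function of its numbers of up-steps arriving at rows and
    at columns, and each up-step shifts [Phi]. The flag [b] tells that the path
    stands at a row. *)
Fixpoint dyck L h b Phi : R :=
  if L is L'.+1 then
    dyck L' h.+1 (~~ b) (fun r c => if b then Phi r c.+1 else Phi r.+1 c)
    + (if h is h'.+1 then dyck L' h' (~~ b) Phi else 0)
  else if h == 0%N then Phi 0%N 0%N else 0.

(** A suffix from height [h] to height 0 has [(L - h) / 2] up-steps, so only the
    values of the weights with [r + c] equal to this matter. This is what lets a
    homogeneous weight be renormalised. *)
Lemma dyck_le L h b Phi Psi :
  (forall r c, (h + (r + c).*2 = L)%N -> Phi r c <= Psi r c) ->
  dyck L h b Phi <= dyck L h b Psi.
Proof.
elim: L h b Phi Psi => [|L IH] h b Phi Psi le_PP /=.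
  by case: eqP => // h0; apply: le_PP; rewrite h0.
apply: lerD.
  apply: IH => r c E; case: b; apply: le_PP; lia.
case: h le_PP => // h le_PP; apply: IH => r c E; apply: le_PP; lia.
Qed.

Lemma dyck_eq L h b Phi Psi :
  (forall r c, (h + (r + c).*2 = L)%N -> Phi r c = Psi r c) ->
  dyck L h b Phi = dyck L h b Psi.
Proof.
by move=> E; apply/eqP; rewrite eq_le !dyck_le // => r c /E ->.
Qed.

Lemma dyckZ L h b a Phi : dyck L h b (fun r c => a * Phi r c) = a * dyck L h b Phi.
Proof.
elim: L h b Phi => [|L IH] h b Phi /=; first by case: eqP; rewrite ?mulr0.
rewrite mulrDr -IH; congr +%R; first by congr dyck; do 2!apply: funext => ?; case: b.
by case: h => [|h]; rewrite ?mulr0 // IH.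
Qed.

Lemma dyck_sum (J : finType) (P : pred J) L h b (Phi : J -> nat -> nat -> R) :
  dyck L h b (fun r c => \sum_(j | P j) Phi j r c) =
  \sum_(j | P j) dyck L h b (Phi j).
Proof.
elim: L h b Phi => [|L IH] h b Phi /=.
  by case: eqP => //; rewrite big1.
rewrite big_split /= -IH; congr +%R.
  by congr dyck; do 2!apply: funext => ?; case: b.
by case: h => [|h]; [rewrite big1|exact: IH].
Qed.

End Dyck.

(** * Closed walks on a bipartite graph *)

Section Walks.
Context {R : realFieldType} {V : finType} (side : V -> bool).
Implicit Types (o u v w : V) (S : {set V}).

(** Both directions of a step cross the same edge, which is named row first. *)
Definition edge u v : V * V := if side u then (u, v) else (v, u).

Lemma edgeC u v : side v != side u -> edge u v = edge v u.
Proof. by rewrite /edge; case: (side u); case: (side v). Qed.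

Lemma edge_eq u v w x : side v != side u -> side x != side w ->
  (edge w x == edge u v) = (w == u) && (x == v) || (w == v) && (x == u).
Proof.
rewrite /edge; case Eu: (side u); case Ev: (side v) => //; case Ew: (side w);
  case Ex: (side x) => // _ _; rewrite xpair_eqE.
- by case: (eqVneq w v) Ew Ev => [->|]; [move=> ->|rewrite orbF].
- by case: (eqVneq w u) Ew Eu => [->|] /=; [move=> ->|rewrite andbC].
- by case: (eqVneq w u) Ew Eu => [->|] /=; [move=> ->|rewrite andbC].
- by case: (eqVneq w v) Ew Ev => [->|] /=; [move=> ->|rewrite orbF andbC].
Qed.

(** Walks of length [L] from [u] to [o]. As a walk proceeds, [q] counts the
    crossings of each edge and [S] collects the visited vertices; the weight [f]
    of the final state may thus depend on the whole walk although no walk is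
    represented. *)
Fixpoint walk_sum o (f : (V * V -> nat) -> {set V} -> R) L u q S : R :=
  if L is L'.+1 then
    \sum_(v | side v != side u)
      walk_sum o f L' v (add_at q (edge u v)) (v |: S)
  else if u == o then f q S else 0.

Lemma walk_sum_ge0 o f L u q S :
  (forall q' S', 0 <= f q' S') -> 0 <= walk_sum o f L u q S.
Proof.
move=> f0; elim: L u q S => [|L IH] u q S /=; first by case: eqP.
by apply: sumr_ge0 => v _; apply: IH.
Qed.

(** A past crossing may be charged to the weight instead of the state. *)
Lemma walk_sum_add_at o f L u q e S :
  walk_sum o f L u (add_at q e) S = walk_sum o (fun q' => f (add_at q' e)) L u q S.
Proof.
elim: L u q S => [|L IH] u q S //=.
by apply: eq_bigr => v _; rewrite add_atC IH.
Qed.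

Lemma walk_sumD o f g L u q S :
  walk_sum o (fun q' S' => f q' S' + g q' S') L u q S =
  walk_sum o f L u q S + walk_sum o g L u q S.
Proof.
elim: L u q S => [|L IH] u q S /=; first by case: eqP => // _; rewrite addr0.
by rewrite -big_split; apply: eq_bigr => v _ /=; rewrite IH.
Qed.

Lemma walk_sumZ o a f L u q S :
  walk_sum o (fun q' S' => a * f q' S') L u q S = a * walk_sum o f L u q S.
Proof.
elim: L u q S => [|L IH] u q S /=; first by case: eqP => // _; rewrite mulr0.
by rewrite mulr_sumr; apply: eq_bigr => v _ /=; rewrite IH.
Qed.

Definition touched (q : V * V -> nat) : {set V * V} := [set e | (0 < q e)%N].

Definition explored q S :=
  (#|S| <= (#|touched q|).+1)%N /\
  forall e, (0 < q e)%N -> e.1 \in S /\ e.2 \in S.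

Lemma edge_mem u v S : ((edge u v).1 \in S /\ (edge u v).2 \in S) <-> (u \in S /\ v \in S).
Proof. by rewrite /edge; case: (side u) => /=; split=> -[]. Qed.

(** A new vertex is entered through a new edge, which is why the visited vertices
    outnumber the crossed edges by at most one. *)
Lemma explored_step q S u v : u \in S -> explored q S ->
  explored (add_at q (edge u v)) (v |: S).
Proof.
move=> uS [cS qS]; split; last first.
  move=> e; rewrite /add_at; case: eqP => [-> _|_].
    by apply/edge_mem; rewrite !inE uS eqxx orbT.
  by rewrite addn0 => /qS[e1 e2]; rewrite !inE e1 e2 !orbT.
have sub : touched q \subset touched (add_at q (edge u v)).
  by apply/fintype.subsetP => e; rewrite !inE /add_at addn_gt0 => ->.
have [vS|vS] := boolP (v \in S).
  rewrite (_ : v |: S = S); last by apply/finset.setUidPr; rewrite finset.sub1set.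
  by apply: leq_trans cS _; rewrite ltnS subset_leq_card.
rewrite cardsU1 vS add1n ltnS; apply: leq_trans cS _.
rewrite proper_card // fintype.properE sub /=; apply/fintype.subsetPn; exists (edge u v).
  by rewrite inE /add_at eqxx addn1.
rewrite inE -leqNgt leqn0; apply/negP => /negP; rewrite -lt0n => /qS /edge_mem[_].
by rewrite (negbTE vS).
Qed.

Lemma sum_add_at (I : finType) (q : I -> nat) e :
  (\sum_x add_at q e x = (\sum_x q x).+1)%N.
Proof.
rewrite /add_at big_split /= -addn1; congr addn.
by rewrite (bigD1 e) //= eqxx big1 ?addn0 // => x /negbTE ->.
Qed.

Lemma walk_sum_le o f g L T u q S :
  u \in S -> explored q S -> (\sum_e q e + L = T)%N ->
  (forall q' S', explored q' S' -> (\sum_e q' e = T)%N -> f q' S' <= g q' S') ->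
  walk_sum o f L u q S <= walk_sum o g L u q S.
Proof.
move=> uS eS qT fg; elim: L u q S uS eS qT => [|L IH] u q S uS eS /= qT.
  by case: eqP => // _; apply: fg; rewrite // -qT addn0.
apply: ler_sum => v _; apply: IH; first by rewrite finset.setU11.
  exact: explored_step.
by rewrite sum_add_at addSnnS.
Qed.

Section Lower.
Variables (mu : V * V -> nat -> R) (o : V) (x y : R) (B : nat).
Hypotheses (mu_ge0 : forall e k, 0 <= mu e k) (mu0 : forall e, mu e 0 = 1)
  (mu2 : forall e, mu e 2 = 1).
Hypotheses (x_ge0 : 0 <= x) (y_ge0 : 0 <= y)
  (x_le : x + B%:R <= #|[pred v | side v]|%:R)
  (y_le : y + B%:R <= #|[pred v | ~~ side v]|%:R).

(** Invariant of the depth-first traversal of a tree standing at [u]: [st] is the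
    branch back to the root, whose edges have been crossed once; the other edges
    met so far have been crossed twice. *)
Definition tree_state u (st : seq V) (q : V * V -> nat) S :=
  [/\ last u st = o, path (fun a b => side b != side a) u st,
      uniq (pairmap edge u st),
      forall e, if e \in pairmap edge u st then q e = 1%N else q e = 0%N \/ q e = 2%N
    & forall e, (0 < q e)%N -> e.1 \in S /\ e.2 \in S].

Lemma tree_state_push u st q S v : side v != side u -> u \in S -> v \notin S ->
  tree_state u st q S ->
  tree_state v (u :: st) (add_at q (edge u v)) (v |: S).
Proof.
move=> uv uS vS [lst pst ust qst qS].
have ne : edge u v \notin pairmap edge u st.
  apply/negP => H; have := qst (edge u v); rewrite H => q1.
  have /qS /edge_mem[_] : (0 < q (edge u v))%N by rewrite q1.
  by rewrite (negbTE vS).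
have q0 : q (edge u v) = 0%N.
  case: (posnP (q (edge u v))) => // /qS /edge_mem[_].
  by rewrite (negbTE vS).
split => //=.
- by rewrite eq_sym uv pst.
- by rewrite -edgeC // ne ust.
- move=> e; rewrite in_cons -edgeC // /add_at; case: eqVneq => [->|_] /=.
    by rewrite q0.
  by rewrite addn0; exact: qst.
- move=> e; rewrite /add_at; case: eqP => [-> _|_].
    by apply/edge_mem; rewrite !inE uS eqxx orbT.
  by rewrite addn0 => /qS[e1 e2]; rewrite !inE e1 e2 !orbT.
Qed.

Lemma tree_state_pop u v st q S :
  tree_state u (v :: st) q S -> tree_state v st (add_at q (edge u v)) (v |: S).
Proof.
move=> [/= lst /andP[uv pst] /andP[ne ust] qst qS].
split => //.
- move=> e; have := qst e; rewrite in_cons /add_at; case: eqVneq => [->|_] /=.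
    by rewrite (negbTE ne) => ->; right.
  by rewrite addn0.
- move=> e; rewrite /add_at; case: eqP => [-> _|_].
    have /qS /edge_mem[uS vS] : (0 < q (edge u v))%N.
      by have := qst (edge u v); rewrite mem_head => ->.
    by apply/edge_mem; rewrite !inE uS eqxx orbT.
  by rewrite addn0 => /qS[e1 e2]; rewrite !inE e1 e2 !orbT.
Qed.

(** Only the depth-first traversals of trees are kept. At most [B] vertices are
    ever visited, which leaves at least [x] rows or [y] columns for an up-step to
    a fresh vertex; a traversal has crossed every edge twice when it is over, so
    its weight is 1. *)
Lemma walk_sum_ge_dyck L u st q S :
  u \in S -> tree_state u st q S -> (#|S| + L <= B)%N ->
  dyck L (size st) (side u) (fun r c => x ^+ r * y ^+ c) <=
  walk_sum o (fun q' _ => \prod_e mu e (q' e)) L u q S.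
Proof.
have wge0 L' u' q' S' : 0 <= walk_sum o (fun q' _ => \prod_e mu e (q' e)) L' u' q' S'.
  by apply: walk_sum_ge0 => ? _; apply: prodr_ge0.
elim: L u st q S => [|L IH] u st q S uS tS SB /=.
  case: st tS => [|v st] tS /=; last by case: ifP => // _; exact: prodr_ge0.
  case: tS => /= -> _ _ qst _; rewrite eqxx !expr0 mulr1 big1 // => e _.
  by have [->|->] := qst e; rewrite ?mu0 ?mu2.
rewrite (bigID (fun v => v \notin S)) /=; apply: lerD.
- set z := if side u then y else x.
  have z_ge0 : 0 <= z by rewrite /z; case: ifP.
  set d := dyck L (size st).+1 (~~ side u) (fun r c => x ^+ r * y ^+ c).
  have d_ge0 : 0 <= d.
    rewrite -(mul0r (dyck L (size st).+1 (~~ side u) (fun r c => x ^+ r * y ^+ c))) -dyckZ.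
    by apply: dyck_le => r c _; rewrite mul0r mulr_ge0 ?exprn_ge0.
  rewrite (@dyck_eq _ _ _ _ _ (fun r c => z * (x ^+ r * y ^+ c))); last first.
    by move=> r c _; rewrite /z; case: (side u); rewrite exprS; ring.
  rewrite dyckZ -/d.
  apply: (@le_trans _ _ (\sum_(v | (side v != side u) && (v \notin S)) d)).
    rewrite sumr_const -[leRHS]mulr_natl; apply: ler_wpM2r => //.
    have: z + B%:R <= #|[pred v | side v != side u]|%:R.
      rewrite /z; case: (side u).
        by rewrite (eq_card (B := [pred v | ~~ side v])) // => v; rewrite !inE; case: (side v).
      by rewrite (eq_card (B := [pred v | side v])) // => v; rewrite !inE; case: (side v).
    rewrite -(cardID [in S] [pred v | side v != side u]) natrD => zB.
    have le1 : (#|[predI [pred v | side v != side u] & [in S]]|%:R : R) <= B%:R.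
      rewrite ler_nat; apply: leq_trans (leq_trans (leq_addr _ _) SB).
      by apply: subset_leq_card; apply/fintype.subsetP => v; rewrite !inE => /andP[].
    have -> : #|[pred v | (side v != side u) && (v \notin S)]| =
        #|[predD [pred v | side v != side u] & [in S]]|.
      by apply: eq_card => v; rewrite !inE andbC.
    by lra.
  apply: ler_sum => v /andP[uv vS]; rewrite /d.
  have -> : ~~ side u = side v by move: uv; case: (side u); case: (side v).
  apply: (IH v (u :: st)); first by rewrite finset.setU11.
    exact: tree_state_push.
  by rewrite cardsU1 vS add1n addSnnS.
- case: st tS => [|v st] tS /=; first by apply: sumr_ge0.
  have [/= _ /andP[uv _] _ qst qS] := tS.
  have [_ vS] : u \in S /\ v \in S.
    apply/edge_mem; apply: qS.
    by have := qst (edge u v); rewrite mem_head => ->.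
  rewrite (bigD1 v) /=; last by rewrite uv vS.
  have -> : ~~ side u = side v by move: uv; case: (side u); case: (side v).
  rewrite -[leLHS]addr0; apply: lerD; last by apply: sumr_ge0.
  apply: IH; [by rewrite finset.setU11|exact: tree_state_pop|].
  rewrite (_ : v |: S = S); last by apply/finset.setUidPr; rewrite finset.sub1set.
  by apply: leq_trans SB; rewrite leq_add2l.
Qed.

End Lower.

End Walks.

(** * Walks with paired crossings *)

(** The ways to match [q] new points with each other and with [m] old points when
    no old point may be left alone: a new point starts a pair or completes one of
    the [m] incomplete ones. This is also the expectation of [x ^ q * He_m(x)] for
    a standard Gaussian [x] and the Hermite polynomial [He_m]. *)
Fixpoint pairings (q m : nat) : nat :=
  if q is q'.+1 then (pairings q' m.+1 + m * pairings q' m.-1)%N else (m == 0%N).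

Lemma pairingsS q m : pairings q.+1 m = (pairings q m.+1 + m * pairings q m.-1)%N.
Proof. by []. Qed.

Lemma pairingsE k m : (pairings (m + k.*2) m * (2 ^ k * k`!) = (m + k.*2)`!)%N.
Proof.
have [q] := ubnP (m + k.*2); elim: q m k => // q IH [|m] [|k] lt //.
- rewrite add0n doubleS pairingsS mul0n addn0.
  have := IH 1%N k; rewrite add1n => /(_ ltac:(lia)) H.
  rewrite expnS [(k.+1)`!]factS [(k.*2.+2)`!]factS -H -addnn; ring.
- rewrite addn0 pairingsS (_ : pairings m m.+2 = 0)%N ?add0n; last first.
    suff: forall a b, (a < b)%N -> pairings a b = 0%N by apply; lia.
    elim=> [|a IHa] [|b] // ab; rewrite pairingsS !IHa ?muln0 //=; lia.
  have := IH m 0%N; rewrite !addn0 !muln1 => /(_ ltac:(lia)) H.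
  by rewrite factS -H.
- rewrite addSn pairingsS mulnDl.
  have H1 := IH m.+2 k ltac:(lia).
  have H2 := IH m k.+1 ltac:(lia).
  have E : (m + k.+1.*2 = m.+2 + k.*2)%N by lia.
  rewrite !E in H2 *.
  transitivity (pairings (m.+2 + k.*2) m.+2 * (2 ^ k * k`!) * (2 * k.+1) +
     m.+1 * (pairings (m.+2 + k.*2) m * (2 ^ k.+1 * k.+1`!)))%N.
    by rewrite expnS factS; ring.
  by rewrite H1 H2 factS -muln2; ring.
Qed.

(** Up to [2 ^ k] the subgaussian bound [k ^ k] is below the Gaussian moment:
    [2 ^ k * (2k - 1)!! = (2k)! / k!] is a product of [k] factors above [k]. *)
Lemma pairings_even_ge k : (k ^ k <= 2 ^ k * pairings k.*2 0)%N.
Proof.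
have H : (2 ^ k * pairings k.*2 0 * k`! = (k.*2)`!)%N.
  by have := pairingsE k 0; rewrite add0n => <-; ring.
rewrite -(leq_pmul2r (fact_gt0 k)) H.
suff: forall j, (k ^ j * k`! <= (k + j)`!)%N by move/(_ k); rewrite addnn.
elim=> [|j IH]; first by rewrite mul1n addn0.
by rewrite addnS factS expnS -mulnA leq_mul // leqW // leq_addr.
Qed.

Section Upper.
Context {R : realFieldType} {V : finType} (side : V -> bool).
Implicit Types (o u v w : V) (S : {set V}) (c : V -> nat) (m q : V * V -> nat).
Variables (K : R) (K_ge1 : 1 <= K).

Fixpoint odd_fact (k : nat) : nat := if k is k'.+1 then (k'.*2.+1 * odd_fact k')%N else 1.

(** An up-step puts a token on the vertex where it arrives. A down-step would take
    one from the vertex that it leaves, but here it leaves [c] unchanged: a vertex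
    having received [c] tokens in total is given the weight [(2c - 1)!!], which
    accounts for all the choices at the down-steps leaving it. *)
Fixpoint token_sum L h b c S : R :=
  if L is L'.+1 then
    \sum_(v | side v != b) token_sum L' h.+1 (~~ b) (add_at c v) (v |: S)
    + (if h is h'.+1 then token_sum L' h' (~~ b) c S else 0)
  else if h == 0%N then (\prod_v (odd_fact (c v))%:R) * K ^- #|S| else 0.

Let K_gt0 : 0 < K. Proof. exact: lt_le_trans K_ge1. Qed.

Lemma token_sum_ge0 L h b c S : 0 <= token_sum L h b c S.
Proof.
elim: L h b c S => [|L IH] h b c S /=.
  by case: ifP => // _; rewrite mulr_ge0 ?prodr_ge0 // invr_ge0 exprn_ge0 // ltW.
rewrite addr_ge0 ?sumr_ge0 //; by case: h.
Qed.

Lemma token_sum_anti L h b c S S' : S \subset S' -> token_sum L h b c S' <= token_sum L h b c S.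
Proof.
elim: L h b c S S' => [|L IH] h b c S S' SS' /=.
  case: ifP => // _; apply: ler_wpM2l; first exact: prodr_ge0.
  by rewrite lef_pV2 ?posrE ?exprn_gt0 // ler_weXn2l // subset_leq_card.
apply: lerD; first by apply: ler_sum => v _; apply: IH; exact: finset.setUS.
by case: h => // h; apply: IH.
Qed.

(** The [2c - 1] choices of a down-step are absorbed through
    [(2c - 1)!! = (2c - 1) * (2c - 3)!!]; tokens still to come at [u] only enlarge
    the factor that is available. *)
Lemma token_sum_del_at L h b c S u : (0 < c u)%N ->
  ((c u).*2.-1)%:R * token_sum L h b (del_at c u) S <= token_sum L h b c S.
Proof.
elim: L h b c S => [|L IH] h b c S cu /=.
  case: ifP => _; last by rewrite mulr0.
  rewrite mulrA; apply: ler_wpM2r; first by rewrite invr_ge0 exprn_ge0 // ltW.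
  rewrite (bigD1 u) //= [leRHS](bigD1 u) //= mulrA -natrM.
  rewrite {1 2}/del_at eqxx; case: (c u) cu => // k _.
  rewrite subn1 doubleS /=; apply: ler_wpM2l => //.
  apply: ler_prod => v /negbTE vu; by rewrite /del_at vu subn0 ler0n lexx.
rewrite mulrDr; apply: lerD.
  rewrite mulr_sumr; apply: ler_sum => v _.
  rewrite -del_add_at //; apply: le_trans (IH _ _ _ _ _); last first.
    by rewrite /add_at addn_gt0 cu.
  apply: ler_wpM2r; first exact: token_sum_ge0.
  rewrite ler_nat /add_at; lia.
case: h => [|h]; first by rewrite mulr0.
exact: IH.
Qed.

(** Here [m] counts the open pairs on each edge. *)
Definition open_degree m u := (\sum_(v | side v != side u) m (edge side u v))%N.

Lemma open_degree_add_at m u v w : side v != side u ->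
  open_degree (add_at m (edge side u v)) w = (open_degree m w + (w == u) + (w == v))%N.
Proof.
move=> uv; rewrite /open_degree /add_at big_split /= -addnA; congr addn.
have nuv : u != v by apply: contraNneq uv => ->.
rewrite (eq_bigr (fun x => (w == u) && (x == v) || (w == v) && (x == u) : nat));
  last by move=> x xw; rewrite edge_eq.
have [->|wu] := eqVneq w u.
  rewrite (negbTE nuv) addn0 (bigD1 v) //= eqxx /= big1 // => x /andP[_ /negbTE ->].
  by [].
rewrite add0n; have [wv|wv] := eqVneq w v; last by rewrite big1.
rewrite (bigD1 u) ?wv ?(eq_sym (side u)) //= eqxx big1 // => x /andP[_ /negbTE ->].
by [].
Qed.

Definition pairing_weight m q : R := \prod_e (pairings (q e) (m e))%:R.

(** A new crossing of [e] opens a pair or closes one of the [m e] open ones. *)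
Lemma pairing_weight_add_at m q e :
  pairing_weight m (add_at q e) = pairing_weight (add_at m e) q + (m e)%:R * pairing_weight (del_at m e) q.
Proof.
rewrite /pairing_weight (bigD1 e) //= [X in _ = X + _](bigD1 e) //=.
rewrite [X in _ = _ + _ * X](bigD1 e) //= /add_at /del_at eqxx !addn1 subn1 /=.
rewrite natrD natrM mulrDl -mulrA.
congr (_ * _ + _ * (_ * _)); apply: eq_bigr => x /negbTE ->; by rewrite ?addn0 ?subn0.
Qed.

Definition damped_weight m q S := K ^- #|S| * pairing_weight m q.

(** The hypothesis is the invariant of the tokens. Opening a pair from [u] to [v]
    raises both degrees by one, moves the walk from [u] to [v] and puts a token on
    [v]; closing one lowers both degrees and takes a token from [u]. Either way
    the invariant survives, and at the current vertex it bounds the number of open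
    pairs by [2 (c u) - 1]. *)
Lemma walk_sum_le_token_sum o L u m c S :
  (forall v, open_degree m v + (v == u) <= (c v).*2)%N ->
  walk_sum side o (damped_weight m) L u (fun _ => 0%N) S <=
  token_sum L (\sum_e m e)%N (side u) c S.
Proof.
elim: L u m c S => [|L IH] u m c S degm /=.
  case: ifP => [_|_]; last first.
    by case: ifP => // _; rewrite mulr_ge0 ?prodr_ge0 // invr_ge0 exprn_ge0 // ltW.
  case: (boolP (\sum_e m e == 0)%N) => m0; last first.
    move: m0; rewrite sum_nat_eq0 negb_forall => /existsP[e /=] me.
    by rewrite /damped_weight /pairing_weight (bigD1 e) //= (negbTE me) mul0r mulr0.
  move: m0; rewrite sum_nat_eq0 => /forallP m0; rewrite /damped_weight mulrC.
  apply: ler_wpM2r; first by rewrite invr_ge0 exprn_ge0 // ltW.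
  rewrite /pairing_weight big1 => [|e _]; last by rewrite (eqP (m0 e)).
  apply: (big_ind (fun x : R => 1 <= x)) => // [x y x1 y1|v _].
    by rewrite -(mulr1 1) ler_pM.
  by rewrite ler1n; elim: (c v) => //= k; rewrite mulSn addn_gt0 => ->.
pose A v := walk_sum side o (damped_weight (add_at m (edge side u v))) L v (fun _ => 0%N) (v |: S).
pose B v := walk_sum side o (damped_weight (del_at m (edge side u v))) L v (fun _ => 0%N) (v |: S).
have -> : \sum_(v | side v != side u) walk_sum side o (damped_weight m) L v
     (add_at (fun _ => 0%N) (edge side u v)) (v |: S) =
   \sum_(v | side v != side u) A v +
   \sum_(v | side v != side u) (m (edge side u v))%:R * B v.
  rewrite -big_split /=; apply: eq_bigr => v uv.
  rewrite walk_sum_add_at /A /B -walk_sumZ -walk_sumD; congr walk_sum.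
  apply: funext => q; apply: funext => S'; rewrite /damped_weight pairing_weight_add_at; ring.
have sv v : side v != side u -> ~~ side u = side v by case: (side u); case: (side v).
apply: lerD.
  apply: ler_sum => v uv; rewrite (sv _ uv) -(sum_add_at m (edge side u v)).
  apply: IH => w; rewrite open_degree_add_at // /add_at.
  have := degm w; lia.
case Eh: (\sum_e m e)%N => [|h].
  rewrite big1 // => v _.
  have -> : m (edge side u v) = 0%N.
    by apply/eqP; move/eqP: Eh; rewrite sum_nat_eq0 => /forallP/(_ (edge side u v)).
  by rewrite mul0r.
have cu : (0 < c u)%N by have := degm u; rewrite eqxx; lia.
(* The current vertex holds a token, which the down-step removes. *)
apply: le_trans (token_sum_del_at _ _ _ _ cu).
apply: (@le_trans _ _ (\sum_(v | side v != side u) (m (edge side u v))%:R *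
   token_sum L h (~~ side u) (del_at c u) S)).
  apply: ler_sum => v uv; have [->|mv] := posnP (m (edge side u v)); first by rewrite !mul0r.
  apply: ler_wpM2l => //; apply: (@le_trans _ _ (token_sum L h (~~ side u) (del_at c u) (v |: S))).
    have -> : h = (\sum_e del_at m (edge side u v) e)%N.
      by apply: succn_inj; rewrite -Eh -(sum_add_at _ (edge side u v)) del_atK.
    rewrite (sv _ uv); apply: IH => w.
    have := degm w; rewrite -{1}(del_atK mv) open_degree_add_at // /del_at; lia.
  by apply: token_sum_anti; rewrite finset.subsetUr.
rewrite -mulr_suml; apply: ler_wpM2r; first exact: token_sum_ge0.
rewrite -natr_sum ler_nat -/(open_degree m u); have := degm u; rewrite eqxx; lia.
Qed.

(** Every occupied box carries a factor [K ^-1], as every visited vertex does in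
    [damped_weight]. *)
Definition token_weight (k : nat) : R := (odd_fact k)%:R * K ^- (0 < k)%N.

End Upper.

(** * Occupation numbers *)

Section Occupancy.
Context {R : realFieldType} {I : finType}.
Implicit Types (P : pred I) (hh : nat -> R) (c : I -> nat).

(** Throw [r] labelled balls into the boxes of [P], which contain [c] at the start:
    the sum over all outcomes of the product of [hh] at the final occupation
    numbers. *)
Fixpoint occupancy P hh r c : R :=
  if r is r'.+1 then \sum_(v | P v) occupancy P hh r' (add_at c v)
  else \prod_(v | P v) hh (c v).

Lemma occupancy_add_out P hh r c w : ~~ P w -> occupancy P hh r (add_at c w) = occupancy P hh r c.
Proof.
move=> Pw; elim: r c => [|r IH] c /=.
  apply: eq_bigr => v Pv; rewrite /add_at; case: eqP => [E|_]; last by rewrite addn0.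
  by rewrite -E Pv in Pw.
by apply: eq_bigr => v Pv; rewrite add_atC IH.
Qed.

Lemma occupancyZ P hh hh' K r c : (forall k, hh' k = K ^+ k * hh k) ->
  occupancy P hh' r c = K ^+ (r + \sum_(v | P v) c v) * occupancy P hh r c.
Proof.
move=> E; elim: r c => [|r IH] c /=.
  rewrite add0n expr_sum -big_split; apply: eq_bigr => v _ /=; exact: E.
rewrite mulr_sumr; apply: eq_bigr => v Pv; rewrite IH; congr (_ ^+ _ * _).
rewrite addSnnS; congr addn; rewrite /add_at big_split /= -addn1; congr addn.
by rewrite (bigD1 v) //= eqxx big1 // => x /andP[_ /negbTE ->].
Qed.

(** The next ball joins a distinguished box or it does not. *)
Lemma pascal_conv r k (H F : nat -> R) :
  \sum_(j < r.+1) 'C(r, j)%:R * H (k.+1 + j)%N * F (r - j)%N +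
  \sum_(j < r.+1) 'C(r, j)%:R * H (k + j)%N * F (r - j).+1 =
  \sum_(j < r.+2) 'C(r.+1, j)%:R * H (k + j)%N * F (r.+1 - j)%N.
Proof.
rewrite [in RHS]big_ord_recl /= bin0 ?subn0 mul1r addn0.
rewrite [in RHS](eq_bigr (fun j : 'I_r.+1 =>
    'C(r, j.+1)%:R * H (k + j.+1)%N * F (r - j)%N +
    'C(r, j)%:R * H (k + j.+1)%N * F (r - j)%N)); last first.
  by move=> j _; rewrite /fintype.bump /= add1n binS subSS natrD !mulrDl.
rewrite big_split /= addrA addrC; congr +%R.
  by apply: eq_bigr => j _; rewrite addnS addSn.
rewrite big_ord_recl /= bin0 ?subn0 mul1r addn0; congr +%R.
rewrite [in RHS]big_ord_recr /= bin_small // !mul0r addr0.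
apply: eq_bigr => j _; rewrite /fintype.bump /= add1n.
by congr (_ * F _); have := ltn_ord j; lia.
Qed.

Section Mono.
Variables (P : pred I) (hh : nat -> R).
Hypotheses (hh0 : hh 0%N = 1) (hh_ge0 : forall k, 0 <= hh k)
  (hh_mono : forall k, hh k <= hh k.+1).

Lemma occupancy_ge0 r c : 0 <= occupancy P hh r c.
Proof.
elim: r c => [|r IH] c /=; first exact: prodr_ge0.
exact: sumr_ge0.
Qed.

Lemma occupancy_add_ge r c v : occupancy P hh r c <= occupancy P hh r (add_at c v).
Proof.
elim: r c => [|r IH] c /=.
  apply: ler_prod => x _; rewrite hh_ge0 /= /add_at.
  by case: eqP; rewrite ?addn0 // addn1 hh_mono.
by apply: ler_sum => x _; rewrite add_atC IH.
Qed.

Lemma occupancyS_ge r c : #|P|%:R * occupancy P hh r c <= occupancy P hh r.+1 c.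
Proof.
rewrite /= mulr_natl -sumr_const; apply: ler_sum => v _; exact: occupancy_add_ge.
Qed.

(** Choose the [j] balls that join the [k] balls put into [v], which [c] leaves
    empty. The other balls should avoid [v]; letting them fall there as well
    enlarges the sum. *)
Lemma occupancy_block r k v c : P v -> c v = 0%N ->
  occupancy P hh r (fun x => c x + k * (x == v))%N <=
  \sum_(j < r.+1) 'C(r, j)%:R * hh (k + j)%N * occupancy P hh (r - j) c.
Proof.
move=> Pv; elim: r k c => [|r IH] k c cv.
  rewrite big_ord1 /= bin0 mul1r addn0 (bigD1 v) //= cv eqxx muln1 add0n.
  rewrite [in leRHS](bigD1 v) //= cv hh0 mul1r.
  rewrite (eq_bigr (fun x => hh (c x))) // => x /andP[_ /negbTE ->].
  by rewrite muln0 addn0.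
rewrite /= (bigD1 v) //=.
have -> : add_at (fun x => c x + k * (x == v))%N v = (fun x => c x + k.+1 * (x == v))%N.
  apply: funext => x; rewrite /add_at; lia.
have swap w : add_at (fun x => c x + k * (x == v))%N w =
    (fun x => add_at c w x + k * (x == v))%N.
  by apply: funext => x; rewrite /add_at; lia.
have H1 := IH k.+1 c cv.
have H2 : \sum_(w | P w && (w != v)) occupancy P hh r (add_at (fun x => c x + k * (x == v))%N w) <=
   \sum_(j < r.+1) 'C(r, j)%:R * hh (k + j)%N * occupancy P hh (r - j).+1 c.
  apply: (@le_trans _ _ (\sum_(w | P w && (w != v)) \sum_(j < r.+1)
     'C(r, j)%:R * hh (k + j)%N * occupancy P hh (r - j) (add_at c w))).
    apply: ler_sum => w /andP[Pw wv]; rewrite swap; apply: IH.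
    by rewrite /add_at cv eq_sym (negbTE wv).
  rewrite exchange_big /=; apply: ler_sum => j _.
  rewrite -mulr_sumr; apply: ler_wpM2l; first by rewrite mulr_ge0.
  by rewrite [leRHS](bigD1 v) //= lerDr occupancy_ge0.
apply: le_trans (lerD H1 H2) _; rewrite le_eqVlt; apply/orP; left; apply/eqP.
exact: (pascal_conv r k hh (fun j => occupancy P hh j c)).
Qed.

Lemma occupancy_step r : occupancy P hh r.+1 (fun=> 0%N) <=
  #|P|%:R * \sum_(j < r.+1) 'C(r, j)%:R * hh j.+1 * occupancy P hh (r - j) (fun=> 0%N).
Proof.
rewrite /= mulr_natl -sumr_const; apply: ler_sum => v Pv.
have := @occupancy_block r 1 v (fun=> 0%N) Pv erefl.
rewrite (_ : (fun x => 0 + 1 * (x == v))%N = add_at (fun=> 0%N) v) //.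
by apply: funext => x; rewrite mul1n.
Qed.

(** As [hh] is nondecreasing, a free ball multiplies the sum by at least [#|P|]. *)
Lemma occupancy_pow r j : (j <= r)%N ->
  #|P|%:R ^+ j * occupancy P hh (r - j) (fun=> 0%N) <= occupancy P hh r (fun=> 0%N).
Proof.
elim: j => [|j IH] jr; first by rewrite mul1r subn0.
apply: le_trans (IH (ltnW jr)); rewrite exprSr -mulrA.
apply: ler_wpM2l; first by rewrite exprn_ge0.
have -> : (r - j = (r - j.+1).+1)%N by lia.
exact: occupancyS_ge.
Qed.

Lemma geom_bound (x : R) n : 0 <= x -> x * 4 <= 1 ->
  \sum_(j < n.+1) (j.+1)%:R * x ^+ j <= 1 + 4 * x.
Proof.
move=> x0 x4.
(* As j + 1 <= 2 ^ j, the tail of the series is at most 2 (2x) ^ (m + 2). *)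
suff H m : \sum_(j < m.+2) (j.+1)%:R * x ^+ j <= 1 + 4 * x - 2 * (2 * x) ^+ m.+2.
  case: n => [|n]; first by rewrite big_ord1 /= expr0 mulr1; lra.
  by apply: le_trans (H n) _; rewrite gerBl mulr_ge0 // exprn_ge0 // mulr_ge0.
elim: m => [|m IH].
  by rewrite big_ord_recr big_ord1 /= expr0 mulr1 expr1; nra.
rewrite big_ord_recr /=.
have t : m.+3%:R * x ^+ m.+2 <= (2 * x) ^+ m.+2.
  by rewrite exprMn; apply: ler_wpM2r; rewrite ?exprn_ge0 // -natrX ler_nat ltn_expl.
have y0 : 0 <= (2 * x) ^+ m.+2 by rewrite exprn_ge0 // mulr_ge0.
have s : (2 * x) ^+ m.+3 <= 2^-1 * (2 * x) ^+ m.+2.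
  by rewrite exprS; apply: ler_wpM2r => //; lra.
lra.
Qed.

Variable (M : R).
Hypotheses (M_ge0 : 0 <= M) (hh_le : forall j, hh j.+1 <= M ^+ j * (j.+1)`!%:R).

(** The box of the last ball contains [j] of the [r] other balls. Binding them to
    it gains a factor [#|P| ^- j], and against ['C(r, j) * hh j.+1] this leaves
    the series of [(j + 1) * (M r / #|P|) ^ j]. *)
Lemma occupancy_ratio r : (0 < #|P|)%N -> M * r%:R * 4 <= #|P|%:R ->
  occupancy P hh r.+1 (fun=> 0%N) <=
  #|P|%:R * (1 + 4 * (M * r%:R / #|P|%:R)) * occupancy P hh r (fun=> 0%N).
Proof.
move=> P0 MP; have P0' : 0 < #|P|%:R :> R by rewrite ltr0n.
apply: le_trans (occupancy_step r) _; rewrite -mulrA; apply: ler_wpM2l => //.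
set x := M * r%:R / #|P|%:R.
apply: (@le_trans _ _ ((\sum_(j < r.+1) j.+1%:R * x ^+ j) * occupancy P hh r (fun=> 0%N))); last first.
  apply: ler_wpM2r; first exact: occupancy_ge0.
  apply: geom_bound; first by rewrite /x !mulr_ge0 // invr_ge0.
  by rewrite /x mulrAC ler_pdivrMr // mul1r.
rewrite mulr_suml; apply: ler_sum => j _.
have jr : (j <= r)%N by rewrite -ltnS.
apply: (@le_trans _ _ ('C(r, j)%:R * (M ^+ j * (j.+1)`!%:R) * occupancy P hh (r - j) (fun=> 0%N))).
  by apply: ler_wpM2r; [exact: occupancy_ge0|apply: ler_wpM2l].
have -> : x ^+ j = (M * r%:R) ^+ j / #|P|%:R ^+ j by rewrite /x expr_div_n.
rewrite -(ler_pM2l (_ : 0 < #|P|%:R ^+ j)) ?exprn_gt0 //.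
rewrite !mulrA (mulrAC (#|P|%:R ^+ j)).
have -> : #|P|%:R ^+ j * j.+1%:R * (M * r%:R) ^+ j / #|P|%:R ^+ j * occupancy P hh r (fun=> 0%N) =
   (j.+1%:R * (M * r%:R) ^+ j) * occupancy P hh r (fun=> 0%N).
  by field; rewrite expf_eq0 andbC; apply/negP => /andP[+ _]; rewrite (gt_eqF P0').
have E : ('C(r, j) * j.+1`! <= j.+1 * r ^ j)%N.
  rewrite factS mulnCA leq_mul2l /= bin_ffact; apply: leq_trans (_ : _ <= \prod_(i < j) r)%N _.
    by rewrite ffact_prod; apply: leq_prod => i _; exact: leq_subr.
  by rewrite prod_nat_const card_ord.
apply: (@le_trans _ _ ('C(r, j)%:R * (M ^+ j * j.+1`!%:R) * (#|P|%:R ^+ j * occupancy P hh (r - j) (fun=> 0%N)))).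
  by rewrite le_eqVlt; apply/orP; left; apply/eqP; ring.
apply: ler_pM; rewrite ?mulr_ge0 ?exprn_ge0 ?occupancy_ge0 ?occupancy_pow //.
rewrite mulrCA exprMn [leRHS]mulrCA; apply: ler_wpM2l; first by rewrite exprn_ge0.
by rewrite -natrX -!natrM ler_nat.
Qed.

Lemma occupancy_le r B : (0 < #|P|)%N -> (r <= B)%N -> M * B%:R * 4 <= #|P|%:R ->
  occupancy P hh r (fun=> 0%N) <=
  #|P|%:R ^+ r * (1 + 4 * (M * B%:R / #|P|%:R)) ^+ r.
Proof.
move=> P0 rB MP; have P0' : 0 < #|P|%:R :> R by rewrite ltr0n.
elim: r rB => [|r IH] rB.
  by rewrite /= big1 ?mul1r.
have Mr : M * r%:R <= M * B%:R by apply: ler_wpM2l => //; rewrite ler_nat ltnW.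
apply: le_trans (occupancy_ratio P0 _) _; first by apply: le_trans MP; rewrite ler_pM2r.
rewrite !exprS mulrACA; apply: ler_pM => //.
- by rewrite mulr_ge0 // addr_ge0 // !mulr_ge0 // invr_ge0.
- exact: occupancy_ge0.
- by apply: ler_wpM2l => //; rewrite lerD2l ler_pM2l // ler_pM2r // invr_gt0.
- exact: IH (ltnW rB).
Qed.

End Mono.
End Occupancy.

Lemma odd_fact_le k : (odd_fact k.+1 <= 2 ^ k * (k.+1)`!)%N.
Proof.
elim: k => // k IH; rewrite factS expnS.
have -> : odd_fact k.+2 = (k.+1.*2.+1 * odd_fact k.+1)%N by [].
apply: leq_trans (leq_mul (_ : _ <= 2 * k.+2)%N IH) _; first lia.
by rewrite -!mulnA leq_mul2l /= mulnCA.
Qed.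

Section TokenSumDyck.
Context {R : realFieldType} {V : finType} (side : V -> bool) (K : R).
Hypothesis K_ge1 : 1 <= K.
Let K_gt0 : 0 < K. Proof. exact: lt_le_trans K_ge1. Qed.

Definition opp_side b : pred V := fun v => side v != b.

(** The weight is a product over the vertices, so for given numbers of up-steps
    towards each side the arrivals at rows and at columns decouple. *)
Lemma token_sum_dyck L h b c (S : {set V}) : S = [set v | (0 < c v)%N] ->
  token_sum side K L h b c S =
  dyck L h b (fun r k => occupancy (opp_side false) (token_weight K) r c *
                         occupancy (opp_side true) (token_weight K) k c).
Proof.
elim: L h b c S => [|L IH] h b c S ->.
  rewrite /=; case: ifP => // _.
  have -> : K ^- #|[set v | (0 < c v)%N]| = \prod_v K ^- (0 < c v)%N.
    rewrite -sum1_card expr_sum -prodfV big_mkcond /=.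
    by apply: eq_bigr => v _; rewrite inE; case: (0 < c v)%N => //=; rewrite invr1.
  rewrite -big_split /= (bigID (opp_side false)) /=; congr (_ * _).
  by apply: eq_bigl => v; rewrite /opp_side; case: (side v).
rewrite /=; congr +%R; last by case: h => // h; rewrite IH.
transitivity (dyck L h.+1 (~~ b) (fun r k => \sum_(v | side v != b)
   occupancy (opp_side false) (token_weight K) r (add_at c v) *
   occupancy (opp_side true) (token_weight K) k (add_at c v))).
  rewrite dyck_sum; apply: eq_bigr => v _; apply: IH.
  apply/finset.setP => x; rewrite !inE /add_at addn_gt0 orbC; by case: (x == v).
apply: dyck_eq => r k _; case: b => /=.
  rewrite mulr_sumr; apply: eq_bigr => v vb; congr (_ * _).
  by rewrite occupancy_add_out // /opp_side; case: (side v) vb.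
rewrite mulr_suml; apply: eq_bigr => v vb; congr (_ * _).
by rewrite occupancy_add_out // /opp_side; case: (side v) vb.
Qed.

End TokenSumDyck.

(** * Two-sided estimate of the sum over closed walks *)

Section Asymptotics.
Context {R : realFieldType} {V : finType} (side : V -> bool).
Variables (mu : V * V -> nat -> R) (K : R).
Hypotheses (K_ge1 : 1 <= K) (mu_ge0 : forall e k, 0 <= mu e k)
  (mu_odd : forall e k, odd k -> mu e k = 0)
  (mu0 : forall e, mu e 0 = 1) (mu2 : forall e, mu e 2 = 1)
  (mu_le : forall e k, mu e k.*2 <= K ^+ k.-1 * (pairings k.*2 0)%:R).

Let K_gt0 : 0 < K. Proof. exact: lt_le_trans K_ge1. Qed.
Let mu_weight (q : V * V -> nat) (_ : {set V}) : R := \prod_e mu e (q e).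

(** An edge crossed [2k > 0] times costs [K ^ (k - 1)], hence all edges together
    cost [K] to the power [p] minus their number; as the edges connect the visited
    vertices, this power is at most [p + 1 - #|S|]. *)
Lemma mu_weight_le p q S : explored q S -> (\sum_e q e = p.*2)%N ->
  mu_weight q S <= K ^+ p.+1 * damped_weight K (fun=> 0%N) q S.
Proof.
move=> [cS _] sq; rewrite /mu_weight /damped_weight mulrA.
have [/forallP ev|] := boolP [forall e, ~~ odd (q e)]; last first.
  rewrite negb_forall => /existsP[e]; rewrite negbK => oe.
  rewrite (bigD1 e) //= mu_odd // mul0r !mulr_ge0 ?exprn_ge0 ?invr_ge0 ?exprn_ge0 ?prodr_ge0 //; exact: ltW.
apply: (@le_trans _ _ (\prod_e (K ^+ (q e)./2.-1 * (pairings (q e) 0)%:R))).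
  apply: ler_prod => e _; rewrite mu_ge0 /=.
  by rewrite -{1 3}(even_halfK (ev e)).
rewrite big_split /=; apply: ler_wpM2r; first exact: prodr_ge0.
rewrite -expr_sum.
have E : (\sum_e (q e)./2.-1 + #|touched q| = p)%N.
  rewrite -sum1_card [X in (_ + X)%N]big_mkcond /= -big_split /=.
  apply: double_inj; rewrite -sq -muln2 big_distrl /=; apply: eq_bigr => e _.
  rewrite inE; have := odd_double_half (q e); rewrite (negbTE (ev e)).
  by move: (q e)./2 => h; case: (ltnP 0 (q e)); lia.
rewrite ler_pdivlMr ?exprn_gt0 // -exprD ler_weXn2l //; rewrite -E -addnS leq_add2l; exact: cS.
Qed.

Let opp := opp_side side.
Let m0 : V * V -> nat := fun=> 0%N.

(** Choosing the root is one more arrival at a row, whence [r.+1]. *)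
Lemma walk_sum_le_dyck p :
  \sum_(o | side o) walk_sum side o mu_weight p.*2 o (fun=> 0%N) [set o] <=
  K ^+ p.+1 * dyck p.*2 0 true (fun r k =>
    occupancy (opp false) (token_weight K) r.+1 (fun=> 0%N) *
    occupancy (opp true) (token_weight K) k (fun=> 0%N)).
Proof.
pose F r k := occupancy (opp false) (token_weight K) r.+1 (fun=> 0%N) *
  occupancy (opp true) (token_weight K) k (fun=> 0%N); rewrite -/F.
have -> : dyck p.*2 0 true F = \sum_(o | side o)
   dyck p.*2 0 true (fun r k => occupancy (opp false) (token_weight K) r (add_at (fun=> 0%N) o) *
     occupancy (opp true) (token_weight K) k (add_at (fun=> 0%N) o)).
  rewrite -dyck_sum; apply: dyck_eq => r k _; rewrite /F /= mulr_suml.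
  apply: eq_big => [v|v so]; first by rewrite /opp /opp_side; case: (side v).
  by rewrite [X in _ = _ * X]occupancy_add_out // /opp /opp_side; move: so; rewrite /opp /opp_side; case: (side v).
rewrite mulr_sumr; apply: ler_sum => o so.
apply: (@le_trans _ _ (walk_sum side o (fun q S => K ^+ p.+1 * damped_weight K m0 q S) p.*2 o (fun=> 0%N) [set o])).
  apply: (@walk_sum_le _ _ side o _ _ p.*2); first by rewrite finset.set11.
  - by split => //; rewrite cards1.
  - by rewrite big1.
  - exact: mu_weight_le.
rewrite walk_sumZ; apply: ler_wpM2l; first by rewrite exprn_ge0 // ltW.
have := @walk_sum_le_token_sum _ _ side K K_ge1 o p.*2 o m0 (add_at (fun=> 0%N) o) [set o].
have s0 : (\sum_e m0 e)%N = 0%N by rewrite big1.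
rewrite s0 so token_sum_dyck //; last first.
  by apply/finset.setP => x; rewrite !inE /add_at; case: (x == o).
apply=> v; rewrite /open_degree big1 // /add_at; by case: (v == o).
Qed.

Let hh k : R := K ^+ k * token_weight K k.

Let hhS k : hh k.+1 = K ^+ k * (odd_fact k.+1)%:R.
Proof. by rewrite /hh /token_weight /= expr1 exprS; field; rewrite gt_eqF. Qed.

Let hh0 : hh 0 = 1. Proof. by rewrite /hh /token_weight /= invr1 !mulr1. Qed.

Let hh_ge0 k : 0 <= hh k.
Proof. by case: k => [|k]; rewrite ?hh0 // hhS mulr_ge0 // exprn_ge0 // ltW. Qed.

Let hh_mono k : hh k <= hh k.+1.
Proof.
case: k => [|k]; first by rewrite hh0 hhS mul1r.
rewrite !hhS; apply: ler_pM => //; first by rewrite exprn_ge0 // ltW.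
  by rewrite exprS ler_peMl // exprn_ge0 // ltW.
by rewrite ler_nat [leqRHS]/= mulSn leq_addr.
Qed.

Let hh_le j : hh j.+1 <= (2 * K) ^+ j * (j.+1)`!%:R.
Proof.
rewrite hhS exprMn (mulrC (2 ^+ j)) -mulrA; apply: ler_wpM2l.
  by rewrite exprn_ge0 // ltW.
by rewrite -natrX -natrM ler_nat odd_fact_le.
Qed.

Lemma expr1D_le (x : R) n : 0 <= x -> 2 * (n%:R * x) <= 1 ->
  (1 + x) ^+ n <= 1 + 2 * (n%:R * x).
Proof.
move=> x0; elim: n => [|n IH] nx; first by rewrite mul0r mulr0 addr0.
rewrite exprS; rewrite -natr1 in nx *.
have n0 : 0 <= n%:R * x by rewrite mulr_ge0.
have nx' : 2 * (n%:R * x) <= 1 by lra.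
apply: (@le_trans _ _ ((1 + x) * (1 + 2 * (n%:R * x)))).
  by apply: ler_wpM2l; [lra|exact: IH].
nra.
Qed.

Lemma expr1B_ge (x : R) n : 0 <= x <= 1 -> 1 - n%:R * x <= (1 - x) ^+ n.
Proof.
move=> /andP[x0 x1]; elim: n => [|n IH]; first by rewrite mul0r subr0.
rewrite exprS -natr1.
apply: (@le_trans _ _ ((1 - x) * (1 - n%:R * x))); last first.
  by apply: ler_wpM2l => //; lra.
have : 0 <= n%:R * x * x by rewrite !mulr_ge0.
lra.
Qed.

Let nr : R := #|[pred v | side v]|%:R.
Let nc : R := #|[pred v | ~~ side v]|%:R.

(** Excluding the visited vertices from the up-steps loses a factor
    [1 - O(p ^ 2 / m)] in the lower bound; [p + 1] applications of the ratio
    bound for occupation numbers lose [1 + O(p ^ 2 / m)] in the upper one. *)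
Lemma walk_sum_asymp p (m : R) : (0 < p)%N -> 0 < m -> m <= nr -> m <= nc ->
  64 * K * p%:R ^+ 2 <= m ->
  `| \sum_(o | side o) walk_sum side o mu_weight p.*2 o (fun=> 0%N) [set o]
     - nr * dyck p.*2 0 true (fun r k => nr ^+ r * nc ^+ k) |
  <= 64 * K * p%:R ^+ 2 / m * (nr * dyck p.*2 0 true (fun r k => nr ^+ r * nc ^+ k)).
Proof.
move=> p_gt0 m_gt0 m_r m_c Kpm; set T := \sum_(o | _) _; set D := dyck _ _ _ _.
have r0 : 0 < nr by apply: lt_le_trans m_r.
have c0 : 0 < nc by apply: lt_le_trans m_c.
have D0 : 0 <= D.
  rewrite -(mul0r D) -dyckZ; apply: dyck_le => r k _.
  by rewrite mul0r mulr_ge0 ?exprn_ge0 // ltW.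
have W0 : 0 <= nr * D by rewrite mulr_ge0 // ltW.
have p1 : 1 <= p%:R :> R by rewrite ler1n.
have Kp : p%:R ^+ 2 <= K * p%:R ^+ 2 by rewrite ler_peMl // exprn_ge0.
have pp : p%:R <= p%:R ^+ 2 :> R by rewrite expr2 ler_peMl.
have cr : #|opp false|%:R = nr.
  by congr (_%:R); apply: eq_card => v; rewrite !unfold_in /opp /opp_side; case: (side v).
have cc : #|opp true|%:R = nc.
  by congr (_%:R); apply: eq_card => v; rewrite !unfold_in /opp /opp_side; case: (side v).
rewrite ler_distl; apply/andP; split.
  (* A walk of length 2p visits at most 2p + 1 vertices. *)
- pose B := (p.*2.+1)%N; pose x := B%:R / m.
  have Bp : B%:R <= 3 * p%:R ^+ 2 :> R.
    rewrite /B -natr1 -mul2n natrM; lra.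
  have x01 : 0 <= x <= 1.
    by rewrite /x divr_ge0 ?(ltW m_gt0) //= ler_pdivrMr // mul1r; lra.
  have [x0 x1] := andP x01.
  have sh z : m <= z -> 0 <= z * (1 - x) /\ z * (1 - x) + B%:R <= z.
    move=> mz; split; first by rewrite mulr_ge0 //; [apply: le_trans mz; exact: ltW|lra].
    rewrite mulrBr mulr1 -addrA gerDl addrC subr_le0 /x mulrCA ler_peMr //.
    by rewrite ler_pdivlMr // mul1r.
  have [xr_ge0 xr_le] := sh _ m_r; have [yc_ge0 yc_le] := sh _ m_c.
  have H o : side o -> dyck p.*2 0 true (fun r k => (nr * (1 - x)) ^+ r * (nc * (1 - x)) ^+ k) <=
     walk_sum side o mu_weight p.*2 o (fun=> 0%N) [set o].
    move=> so; rewrite -so.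
    apply: (@walk_sum_ge_dyck _ _ side mu o _ _ B mu_ge0 mu0 mu2 xr_ge0 yc_ge0 xr_le yc_le p.*2 o [::]).
    + by rewrite finset.set11.
    + by split => // e; left.
    + by rewrite cards1.
  apply: le_trans (ler_sum _ H); rewrite sumr_const -[leRHS]mulr_natl -[#|side|%:R]/nr.
  rewrite (@dyck_eq _ _ _ _ _ (fun r k => (1 - x) ^+ p * (nr ^+ r * nc ^+ k))); last first.
    move=> r k; rewrite add0n => /double_inj <-; rewrite !exprMn exprD; ring.
  rewrite dyckZ -/D [leRHS]mulrCA.
  apply: (@le_trans _ _ ((1 - p%:R * x) * (nr * D))); last first.
    by apply: ler_wpM2r => //; exact: expr1B_ge.
  rewrite mulrBl mul1r lerD2l lerN2; apply: ler_wpM2r => //.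
  rewrite /x mulrA ler_pM2r ?invr_gt0 //.
  have : p%:R * B%:R = 2 * p%:R ^+ 2 + p%:R :> R.
    by rewrite /B -natr1 -mul2n natrM; ring.
  lra.
- pose M := 2 * K; pose B := p.+1; pose x := 4 * (M * B%:R / m).
  have M0 : 0 <= M by rewrite mulr_ge0 // ltW.
  have x0 : 0 <= x by apply: mulr_ge0 => //; apply: divr_ge0; [exact: mulr_ge0|exact: ltW].
  have BB : B%:R * B%:R <= 4 * p%:R ^+ 2 :> R by rewrite /B -natr1; nra.
  have KB : K * (B%:R * B%:R) <= 4 * (K * p%:R ^+ 2).
    by rewrite [leRHS]mulrCA ler_pM2l.
  have KB1 : K * B%:R <= K * (B%:R * B%:R).
    by rewrite ler_pM2l // ler_peMl // /B ler1n.
  have xB : 2 * (B%:R * x) <= 64 * K * p%:R ^+ 2 / m.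
    have -> : 2 * (B%:R * x) = 16 * (K * (B%:R * B%:R)) / m by rewrite /x /M; ring.
    by rewrite ler_pM2r ?invr_gt0 // -mulrA; lra.
  have xB1 : 2 * (B%:R * x) <= 1.
    by apply: le_trans xB _; rewrite ler_pdivrMr // mul1r.
  have small z : m <= z -> M * B%:R * 4 <= z.
    move=> mz; apply: le_trans mz; rewrite /M; lra.
  apply: le_trans (walk_sum_le_dyck p) _; rewrite -dyckZ.
  have step z r : m <= z -> (r <= B)%N -> (1 + 4 * (M * B%:R / z)) ^+ r <= (1 + x) ^+ r.
    move=> mz rB; have z0 : 0 < z by apply: lt_le_trans mz.
    apply: lerXn2r; rewrite ?nnegrE.
    + by rewrite addr_ge0 //; apply: mulr_ge0 => //; apply: divr_ge0; [exact: mulr_ge0|exact: ltW].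
    + by rewrite addr_ge0.
    + rewrite lerD2l /x ler_pM2l //; apply: ler_wpM2l; first exact: mulr_ge0.
      by rewrite lef_pV2 ?posrE.
  apply: (@le_trans _ _ (dyck p.*2 0 true (fun r k => (1 + x) ^+ B * (nr * (nr ^+ r * nc ^+ k))))).
    apply: dyck_le => r k; rewrite add0n => /double_inj rk.
    have -> : K ^+ p.+1 * (occupancy (opp false) (token_weight K) r.+1 (fun=> 0%N) *
        occupancy (opp true) (token_weight K) k (fun=> 0%N)) =
      occupancy (opp false) hh r.+1 (fun=> 0%N) * occupancy (opp true) hh k (fun=> 0%N).
      rewrite !(@occupancyZ _ _ _ (token_weight K) hh K) // !big1 // !addn0 -rk -addSn exprD; ring.
    have rB : (r.+1 <= B)%N by rewrite /B ltnS -rk leq_addr.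
    have kB : (k <= B)%N by rewrite /B -rk; apply: leqW; exact: leq_addl.
    have Hr : occupancy (opp false) hh r.+1 (fun=> 0%N) <= nr ^+ r.+1 * (1 + x) ^+ r.+1.
      apply: (@le_trans _ _ (nr ^+ r.+1 * (1 + 4 * (M * B%:R / nr)) ^+ r.+1)).
        rewrite -cr; apply: (@occupancy_le _ _ _ hh hh0 hh_ge0 hh_mono M M0 hh_le) => //.
        + by rewrite -(ltr_nat R) cr.
        + by rewrite cr; exact: small.
      by apply: ler_wpM2l; [rewrite exprn_ge0 // ltW|exact: step].
    have Hk : occupancy (opp true) hh k (fun=> 0%N) <= nc ^+ k * (1 + x) ^+ k.
      apply: (@le_trans _ _ (nc ^+ k * (1 + 4 * (M * B%:R / nc)) ^+ k)).
        rewrite -cc; apply: (@occupancy_le _ _ _ hh hh0 hh_ge0 hh_mono M M0 hh_le) => //.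
        + by rewrite -(ltr_nat R) cc.
        + by rewrite cc; exact: small.
      by apply: ler_wpM2l; [rewrite exprn_ge0 // ltW|exact: step].
    apply: le_trans (ler_pM _ _ Hr Hk) _; try exact: occupancy_ge0.
    rewrite /B -rk -addSn exprD exprS; rewrite le_eqVlt; apply/orP; left; apply/eqP; ring.
  rewrite !dyckZ -/D.
  rewrite [leRHS](_ : _ = (1 + 64 * K * p%:R ^+ 2 / m) * (nr * D)); last first.
    by rewrite [RHS]mulrDl mul1r.
  apply: ler_wpM2r => //.
  by apply: le_trans (expr1D_le x0 xB1) _; rewrite lerD2l.
Qed.

End Asymptotics.

Local Open Scope classical_set_scope.
Local Open Scope ring_scope.

(** * Moments of the Marchenko-Pastur law *)

Section Moments.
Context {R : realType} (g : R).
Hypothesis g_gt0 : 0 < g.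
Local Notation leb := (@lebesgue_measure R).

(** Motzkin suffixes of length [L] from height [l], with weight [g] for an up-step,
    [1 + g] for a level step and 1 for a down-step. *)
Fixpoint motzkin (L l : nat) : R :=
  if L is L'.+1 then
    g * motzkin L' l.+1 + (1 + g) * motzkin L' l
    + (if l is l'.+1 then motzkin L' l' else 0)
  else (l == 0%N)%:R.

Lemma motzkin_ge0 L l : 0 <= motzkin L l.
Proof.
have g0 := ltW g_gt0; elim: L l => [|L IH] l //=.
rewrite !addr_ge0 ?mulr_ge0 //; first by rewrite addr_ge0.
by case: l.
Qed.

Lemma motzkin_gt0 L : 0 < motzkin L 0.
Proof.
elim: L => [|L IH] //=; rewrite addr0.
by rewrite ltr_wpDl ?mulr_ge0 ?motzkin_ge0 ?(ltW g_gt0) // mulr_gt0 // addr_gt0.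
Qed.

(** Read two Dyck steps at a time from an odd height, where the path stands at a
    column: UU weighs [g], UD weighs [g], DU weighs 1 and DD weighs 1. From height
    1 the block DU goes through height 0, so level steps weigh [1 + g] at the
    bottom as well. The last step goes from height 1 to 0. *)
Lemma dyck_motzkin L l :
  dyck L.*2.+1 l.*2.+1 false (fun r k => g ^+ r) = motzkin L l.
Proof.
elim: L l => [|L IH] l; first by case: l => [|l] /=; rewrite ?addr0 ?add0r.
have DT M h (Phi : nat -> nat -> R) : dyck M.+1 h true Phi =
  dyck M h.+1 false (fun r k => Phi r k.+1) + (if h is h'.+1 then dyck M h' false Phi else 0).
  by [].
have DF M h (Phi : nat -> nat -> R) : dyck M.+1 h.+1 false Phi =
  dyck M h.+2 true (fun r k => Phi r.+1 k) + dyck M h true Phi.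
  by [].
rewrite doubleS DF !DT.
have S h : dyck L.*2.+1 h false (fun r (k : nat) => g ^+ r.+1) =
    g * dyck L.*2.+1 h false (fun r k => g ^+ r).
  by rewrite -dyckZ; apply: dyck_eq => r k _; rewrite exprS.
rewrite !S (_ : l.*2.+3 = l.+1.*2.+1) // !IH.
have -> : (if l.*2 is h'.+1 then dyck L.*2.+1 h' false (fun r k => g ^+ r) else 0) =
   (if l is l'.+1 then motzkin L l' else 0) by case: (l) => [|l'] //; exact: IH.
by case: l => [|l] /=; ring.
Qed.

Lemma dyck_moment p :
  dyck p.+1.*2 0 true (fun r k => g ^+ r) = motzkin p 0.
Proof. by rewrite -dyck_motzkin doubleS [LHS]/= addr0. Qed.

Definition mp_param (t : R) : R := 1 + g + 2 * Num.sqrt g * cos t.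

(** Since [sin (l t) / sin t] is the Chebyshev polynomial of index [l - 1] in
    [cos t], this is, up to a constant, the integral of [x ^ L] times this
    polynomial against a semicircle law. *)
Definition sine_moment (L l : nat) : R :=
  \int[leb]_(t in `[0, pi]) (mp_param t ^+ L * (sin (l%:R * t) * sin t)).

Lemma continuous_mp_param : continuous mp_param.
Proof.
move=> t; apply: cvgD; first exact: cvg_cst.
by apply: cvgM; [exact: cvg_cst|exact: continuous_cos].
Qed.

Lemma continuous_sinM (l : R) : continuous (fun t : R => sin (l * t)).
Proof.
move=> t; apply: (@continuous_comp _ _ _ (fun t => l * t) sin).
  exact: mulrl_continuous.
exact: continuous_sin.
Qed.

Lemma continuous_int (f : R -> R) : continuous f ->
  leb.-integrable `[0, pi] (EFin \o f).
Proof.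
move=> cf; apply: continuous_compact_integrable; first exact: segment_compact.
exact: continuous_subspaceT.
Qed.

Lemma continuous_exprn (f : R -> R) k : continuous f -> continuous (fun t => f t ^+ k).
Proof.
move=> cf; elim: k => [|k IH] t; first by under eq_fun do rewrite expr0; exact: cvg_cst.
by under eq_fun do rewrite exprS; apply: cvgM; [exact: cf|exact: IH].
Qed.

Lemma continuous_sine_integrand L l :
  continuous (fun t => mp_param t ^+ L * (sin (l%:R * t) * sin t)).
Proof.
move=> t; apply: cvgM; first exact: continuous_exprn continuous_mp_param _.
by apply: cvgM; [exact: continuous_sinM|exact: continuous_sin].
Qed.

(** As [2 cos t sin (l t) = sin ((l + 1) t) + sin ((l - 1) t)], multiplication by
    [mp_param] acts on [l] as a Motzkin step. *)
Lemma sine_moment_rec L l : sine_moment L.+1 l.+1 =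
  (1 + g) * sine_moment L l.+1 + Num.sqrt g * (sine_moment L l.+2 + sine_moment L l).
Proof.
have ci k := continuous_int (@continuous_sine_integrand L k).
rewrite /sine_moment -RintegralD // -!RintegralZl //; last first.
  by apply: continuous_int => t; apply: cvgD; exact: continuous_sine_integrand.
rewrite -RintegralD //; last 2 first.
- apply: continuous_int => t; apply: cvgM; [exact: cvg_cst|exact: continuous_sine_integrand].
- apply: continuous_int => t; apply: cvgM; first exact: cvg_cst.
  by apply: cvgD; exact: continuous_sine_integrand.
apply: eq_Rintegral => t _.
have -> : l.+2%:R * t = l.+1%:R * t + t by rewrite -[l.+2%:R]natr1; ring.
have -> : l%:R * t = l.+1%:R * t - t by rewrite -[l.+1%:R]natr1; ring.
rewrite sinD sinB exprS /mp_param; ring.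
Qed.

Lemma sine_moment0 L : sine_moment L 0 = 0.
Proof.
transitivity (\int[leb]_(t in `[0, pi]) (cst 0 t : R)).
  by apply: eq_Rintegral => t _; rewrite mul0r sin0 mul0r mulr0.
by rewrite Rintegral_cst // mul0r.
Qed.

#[local] Instance is_derive_sinM (l t : R) :
  is_derive t 1 (fun t => sin (l * t)) (l * cos (l * t)).
Proof.
have H : is_derive t 1 (fun t : R => l * t) l by apply: is_derive_eq; rewrite scaler1.
by rewrite mulrC; exact: is_derive1_comp.
Qed.

Lemma FTC_0_pi (f F : R -> R) : (forall t : R, is_derive t 1 F (f t)) -> continuous f ->
  \int[leb]_(t in `[0, pi]) f t = F pi - F 0.
Proof.
move=> dF cf.
have cF : continuous F.
  move=> t; apply/differentiable_continuous/derivable1_diffP.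
  exact: (@ex_derive _ _ _ _ _ _ _ (dF t)).
rewrite /Rintegral (@continuous_FTC2 _ f F) ?pi_gt0 //.
- exact: continuous_subspaceT.
- split; first by move=> t _; exact: (@ex_derive _ _ _ _ _ _ _ (dF t)).
    by apply: cvg_at_right_filter; exact: cF.
  by apply: cvg_at_left_filter; exact: cF.
- by move=> t _; rewrite derive1E (@derive_val _ _ _ _ _ _ _ (dF t)).
Qed.

Lemma sin_natpi l : sin (l%:R * pi) = 0 :> R.
Proof.
elim: l => [|l IH]; first by rewrite mul0r sin0.
by rewrite -natr1 mulrDl mul1r sinD IH sinpi mul0r mulr0 addr0.
Qed.

(** Orthogonality of [sin t] and [sin (l t)]. *)
Lemma sine_moment_base l : sine_moment 0 l.+1 = (l == 0)%N%:R * (pi / 2).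
Proof.
rewrite /sine_moment.
have E (t : R) : sin (l.+1%:R * t) * sin t = (cos (l%:R * t) - cos (l.+2%:R * t)) / 2.
  have -> : l.+2%:R * t = l.+1%:R * t + t by rewrite -[l.+2%:R]natr1; ring.
  have -> : l%:R * t = l.+1%:R * t - t by rewrite -[l.+1%:R]natr1; ring.
  by rewrite cosB cosD; field.
pose F (t : R) := (if l == 0%N then 2^-1 * t else (2 * l%:R)^-1 * sin (l%:R * t))
   - (2 * l.+2%:R)^-1 * sin (l.+2%:R * t).
have dF (t : R) : is_derive t 1 F (mp_param t ^+ 0 * (sin (l.+1%:R * t) * sin t)).
  rewrite expr0 mul1r E /F; case: eqP => [->|/eqP l0].
    by apply: is_derive_eq; rewrite mul0r cos0 /GRing.scale /=; field.
  by apply: is_derive_eq; rewrite /GRing.scale /=; field; rewrite -natrD !pnatr_eq0 l0.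
rewrite (FTC_0_pi dF); last exact: continuous_sine_integrand.
rewrite /F !mulr0 sin0 !mulr0 sin_natpi mulr0 !subr0.
by case: (l == 0)%N; rewrite /= ?sin_natpi; ring.
Qed.

(** The factor [sqrt g ^ l] makes the symmetric weights [sqrt g] of the up- and
    down-steps into [g] and 1. *)
Lemma sine_moment_motzkin L l : sine_moment L l.+1 = pi / 2 * Num.sqrt g ^+ l * motzkin L l.
Proof.
have s2 : g = Num.sqrt g * Num.sqrt g by rewrite -expr2 sqr_sqrtr // ltW.
elim: L l => [|L IH] l.
  by rewrite sine_moment_base /=; case: l => [|l] /=; rewrite ?expr0; ring.
rewrite sine_moment_rec [motzkin L.+1 l]/=.
case: l => [|l]; rewrite ?sine_moment0 !IH; move: (Num.sqrt g) s2 => s ->; rewrite !exprS.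
  by rewrite expr0; ring.
by ring.
Qed.

(** Under [x = mp_param t] the square root in the density is [2 sqrt g sin t], and
    so is [- dx / dt]. The factor [x] in the denominator is cancelled by
    [x ^ p.+1]. *)
Lemma mp_moment_sine p : mp_moment p.+1 g = 2 / pi * sine_moment p 1.
Proof.
have pi0 : pi != 0 :> R by rewrite gt_eqF ?pi_gt0.
have s_gt0 : 0 < Num.sqrt g by rewrite sqrtr_gt0.
have s2 : Num.sqrt g * Num.sqrt g = g by rewrite -expr2 sqr_sqrtr // ltW.
set s := Num.sqrt g in s_gt0 s2 *.
pose q (x : R) : R := (mp_right g - x) * (x - mp_left g).
pose G (x : R) : R := x ^+ p * (Num.sqrt (q x) / (2 * pi * g)).
have -> : mp_moment p.+1 g = \int[leb]_(x in `[mp_left g, mp_right g]) G x.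
  apply: eq_Rintegral => x; rewrite inE /= in_itv /= => /andP[ax xb].
  rewrite /G /mp_density -/(q x).
  (* The point 0 belongs to the support only when it is its left end. *)
  have [x0|x0] := eqVneq x 0.
    have : mp_left g = 0.
      by apply/eqP; rewrite eq_le -{1}x0 ax /= /mp_left exprn_even_ge0.
    by rewrite /q x0 => ->; rewrite !subr0 mulr0 sqrtr0 !mul0r !mulr0.
  rewrite exprSr; move: (pi) pi0 => P P0.
  by field; rewrite x0 P0 gt_eqF.
have F0 : mp_param 0 = mp_right g.
  by rewrite /mp_param /mp_right cos0 -/s -{1}s2; ring.
have Fpi : mp_param pi = mp_left g.
  by rewrite /mp_param /mp_left cospi -/s -{1}s2; ring.
have dF (t : R) : is_derive t 1 mp_param (- (2 * s * sin t)).
  by rewrite /mp_param; apply: is_derive_eq; rewrite /GRing.scale /= -/s; ring.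
have dFE (t : R) : derive1 mp_param t = - (2 * s * sin t).
  by rewrite derive1E (@derive_val _ _ _ _ _ _ _ (dF t)).
have cG : continuous G.
  move=> x; apply: cvgM; first by apply: continuous_exprn => y; exact: cvg_id.
  apply: cvgM; last exact: cvg_cst.
  apply: (@continuous_comp _ _ _ q Num.sqrt); last exact: sqrt_continuous.
  by apply: cvgM; apply: cvgB; (exact: cvg_cst || exact: cvg_id).
have cD : continuous (fun t : R => - (2 * s * sin t)).
  move=> t; apply: cvgN; apply: cvgM; [exact: cvg_cst|exact: continuous_sin].
rewrite /Rintegral -Fpi -F0 integration_by_substitution_decreasing //.
- rewrite -[LHS]/(\int[leb]_(t in `[0, pi]) (((G \o mp_param) * - derive1 mp_param) t)).
  rewrite /sine_moment -RintegralZl //; last exact/continuous_int/continuous_sine_integrand.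
  apply: eq_Rintegral => t; rewrite inE /= in_itv /= => tpi.
  transitivity (G (mp_param t) * - derive1 mp_param t); first by [].
  rewrite dFE opprK /G mul1r.
  have -> : q (mp_param t) = (2 * s * sin t) ^+ 2.
    rewrite exprMn sin2cos2 /q -F0 -Fpi /mp_param cos0 cospi -/s; ring.
  rewrite sqrtr_sqr ger0_norm; last first.
    by rewrite !mulr_ge0 ?(ltW s_gt0) // sin_ge0_pi.
  move: (pi) pi0 => P P0.
  rewrite -s2; field; rewrite P0 gt_eqF //.
- exact: pi_ge0.
- move=> x y xI yI xy; rewrite /mp_param ltrD2l ltr_pM2l ?mulr_gt0 //.
  by rewrite ltr_cos.
- by move=> t _; rewrite (_ : derive1 mp_param = fun t => - (2 * s * sin t)) //; apply/funext.
- rewrite (_ : derive1 mp_param = fun t => - (2 * s * sin t)); last exact/funext.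
  by apply/cvg_ex; eexists; apply: cvg_at_right_filter; exact: cD.
- rewrite (_ : derive1 mp_param = fun t => - (2 * s * sin t)); last exact/funext.
  by apply/cvg_ex; eexists; apply: cvg_at_left_filter; exact: cD.
- split; first by move=> t _; exact: (@ex_derive _ _ _ _ _ _ _ (dF t)).
    by apply: cvg_at_right_filter; exact: continuous_mp_param.
  by apply: cvg_at_left_filter; exact: continuous_mp_param.
- exact: continuous_subspaceT.
Qed.

Lemma mp_moment_dyck p :
  mp_moment p.+1 g = dyck p.+1.*2 0 true (fun r k => g ^+ r).
Proof.
rewrite mp_moment_sine sine_moment_motzkin dyck_moment expr0 mulr1 mulrA.
have H : 2 / pi * (pi / 2) = 1 :> R.
  by move: pi (pi_gt0 R) => P P0; field; rewrite gt_eqF.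
by rewrite H mul1r.
Qed.

Lemma mp_moment_gt0 p : 0 < mp_moment p.+1 g.
Proof. by rewrite mp_moment_dyck dyck_moment motzkin_gt0. Qed.

End Moments.

(** * Expectation of a product of independent variables *)

Section IndicExt.
Local Open Scope ereal_scope.
Context d d' (T : measurableType d) (T' : measurableType d') (R : realType).
Variables (mu : {measure set T -> \bar R}) (X Y : T -> T').
Hypotheses (mX : measurable_fun setT X) (mY : measurable_fun setT Y).
Variables (g : T -> R) (c : R).
Hypotheses (mg : measurable_fun setT g) (g_ge0 : forall w, (0 <= g w)%R).
Hypothesis indic_eq : forall B : set T', measurable B ->
  \int[mu]_w ((g w)%:E * (\1_B (X w))%:E) = c%:E * \int[mu]_w (\1_B (Y w))%:E.

Import HBNNSimple.

Let nnsfun_eq (h : {nnsfun T' >-> R}) :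
  \int[mu]_w ((g w)%:E * (h (X w))%:E) = c%:E * \int[mu]_w (h (Y w))%:E.
Proof.
have ih_ge0 r x : 0 <= (r * \1_(h @^-1` [set r]) x)%:E by rewrite EFinM nnfun_muleindic_ge0.
have mi (B : set T') (Z : T -> T') : measurable_fun setT Z -> measurable B ->
    measurable_fun setT (fun w => (\1_B (Z w))%:E : \bar R).
  move=> mZ mB; apply/measurable_EFinP.
  exact: (measurableT_comp (measurable_indic mB)) mZ.
have mri (B : set T') (Z : T -> T') r : measurable_fun setT Z -> measurable B ->
    measurable_fun setT (fun w => (r * \1_B (Z w))%:E).
  move=> mZ mB; apply/measurable_EFinP.
  by apply: (@measurable_funM _ _ _ _ (cst r) (fun w => \1_B (Z w))) ; [exact: measurable_cst|exact: (measurableT_comp (measurable_indic mB) mZ)].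
have mgE : measurable_fun setT (fun w => (g w)%:E) by exact/measurable_EFinP.
under [LHS]eq_integral => w _ do
  rewrite fimfunE -fsumEFin// ge0_mule_fsumr//.
rewrite [LHS]ge0_integral_fsum//; last 2 first.
  - move=> r; apply: emeasurable_funM => //; apply: mri => //.
  - by move=> r w _; rewrite mule_ge0 // lee_fin.
under [in RHS]eq_integral => w _ do rewrite fimfunE -fsumEFin//.
rewrite [in RHS]ge0_integral_fsum//; last first.
  - by move=> r; apply: mri => //.
rewrite ge0_mule_fsumr; last by move=> r; apply: integral_ge0.
apply: eq_fsbigr => r _.
have [r0|r0] := leP 0%R r; last first.
  have -> : h @^-1` [set r] = set0.
    by apply/seteqP; split => // x /= hx; move: r0; rewrite -hx ltNge fun_ge0.
  under eq_integral do rewrite indic0 mulr0 mule0.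
  under [in RHS]eq_integral do rewrite indic0 mulr0.
  by rewrite !integral0 mule0.
under eq_integral do rewrite EFinM muleCA.
rewrite ge0_integralZl//; last 2 first.
  - by apply: emeasurable_funM => //; exact: mi.
  - by move=> w _; rewrite mule_ge0 // lee_fin.
under [in RHS]eq_integral do rewrite EFinM.
rewrite [in RHS]ge0_integralZl//; last exact: mi.
by rewrite indic_eq // muleCA.
Qed.

(** The usual passage from indicators to simple functions and then, by monotone
    convergence, to non-negative functions. With [Y = X] it says that [X] is
    independent of the weight [g] of mean [c]; with [g = c = 1] that [X] and [Y]
    have the same law. *)
Lemma ge0_integral_indic_ext (f : T' -> \bar R) :
  measurable_fun setT f -> (forall x, 0 <= f x) ->
  \int[mu]_w ((g w)%:E * f (X w)) = c%:E * \int[mu]_w f (Y w).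
Proof.
move=> mf f0; pose f_ := nnsfun_approx measurableT mf.
have fcvg x : EFin \o f_ ^~ x @ \oo --> f x by apply: cvg_nnsfun_approx.
have fnd x : nondecreasing_seq (fun n => (f_ n x)%:E).
  by move=> a b ab; rewrite lee_fin; exact/lefP/nd_nnsfun_approx.
have mfX n (Z : T -> T') : measurable_fun setT Z ->
    measurable_fun setT (fun w => (f_ n (Z w))%:E).
  by move=> mZ; apply/measurable_EFinP; exact: measurableT_comp.
transitivity (limn (fun n => \int[mu]_w ((g w)%:E * (f_ n (X w))%:E))).
  rewrite -monotone_convergence//=.
  - apply: eq_integral => w _; apply/esym/cvg_lim => //=.
    by apply: cvgeZl => //; exact: fcvg.
  - by move=> n; apply: emeasurable_funM ; [exact/measurable_EFinP|exact: mfX].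
  - by move=> n w _; rewrite mule_ge0 // lee_fin.
  - by move=> w _ a b ab; apply: lee_wpmul2l; [rewrite lee_fin|exact: fnd].
rewrite (_ : \int[mu]_w f (Y w) =
    limn (fun n => \int[mu]_w (f_ n (Y w))%:E)); last first.
  rewrite -monotone_convergence//=.
  - by apply: eq_integral => w _; apply/esym/cvg_lim => //; exact: fcvg.
  - by move=> n; exact: mfX.
  - by move=> n w _; rewrite lee_fin.
rewrite -limeMl//.
  by congr (limn _); apply/funext => n /=; rewrite nnsfun_eq.
apply/ereal_nondecreasing_is_cvgn => a b ab; apply: ge0_le_integral => //.
- by move=> x _; rewrite lee_fin.
- exact: mfX.
- exact: mfX.
- by move=> x _; exact: fnd.
Qed.

End IndicExt.

Section IndicatorProduct.
Context d (T : measurableType d) (R : realType) (P : probability T R).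
Context (I : finType) (X : I -> {RV P >-> R}).
Hypothesis indep : mutually_independent X.
Implicit Types h : I -> R -> R.

Let mhX h (i : I) : measurable_fun setT (h i) ->
  measurable_fun setT (fun w => h i (X i w)).
Proof. by move=> mh; exact: measurableT_comp. Qed.

(** Independence is the case where every [h i] is an indicator. The indicators are
    replaced one coordinate at a time; [s] lists the coordinates where this has
    been done. *)
Lemma indep_prod_ge0 (s : seq I) h :
  (forall i, measurable_fun setT (h i)) -> (forall i x, 0 <= h i x) ->
  (forall i, P.-integrable setT (fun w => (h i (X i w))%:E)) ->
  (forall i, i \notin s -> exists2 B, measurable B & h i = \1_B) ->
  (\int[P]_w (\prod_i h i (X i w))%:E =
   (\prod_i \int[P]_w h i (X i w))%:E)%E.
Proof.
elim: s h => [|a s IH] h mh h0 ih hs.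
  have {hs} hs i : exists B, measurable B /\ h i = \1_B.
    by have [//|B mB hB] := hs i; exists B.
  have [B HB] := choice hs.
  have mXB i : measurable (X i @^-1` B i) by apply: measurable_funPTI; exact: (HB i).1.
  have -> : (fun w => (\prod_i h i (X i w))%:E) =
      (fun w => (\1_(\bigcap_(i in [set` [set: I]%SET]) (X i @^-1` B i)) w)%:E).
    apply/funext => w; congr (_%:E); rewrite indicE.
    have [wB|wB] := boolP (w \in \bigcap_(i in [set` [set: I]%SET]) (X i @^-1` B i)).
      rewrite big1 // => i _; rewrite (HB i).2 indicE mem_set //.
      by move/set_mem: wB; apply; rewrite /= inE.
    have [i wi] : exists i, ~ B i (X i w).
      apply: contrapT => H; move/negP: wB; apply; apply/mem_set => i _ /=.
      by apply: contrapT => Hi; apply: H; exists i.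
    by rewrite (bigD1 i) //= (HB i).2 indicE memNset // mul0r.
  rewrite integral_indic //; last first.
    by apply: fin_bigcap_measurable => // i _; exact: mXB.
  rewrite setIT; etransitivity.
    by apply: (indep (J := [set: I]%SET)) => i _; exact: (HB i).1.
  rewrite -prodEFin; apply: eq_big => [i|i _]; first by rewrite inE.
  rewrite /Rintegral fineK; last exact: integrable_fin_num.
  have -> : (fun w => (h i (X i w))%:E) = (fun w => (\1_(X i @^-1` B i) w)%:E).
    by apply/funext => w; rewrite (HB i).2 !indicE.
  by rewrite integral_indic // setIT.
have mg : measurable_fun setT (fun w => \prod_(i | i != a) h i (X i w)).
  under eq_fun do rewrite big_mkcond.
  apply: measurable_prod => i _; case: (i != a); first exact: mhX.
  exact: measurable_cst.
pose c := \prod_(i | i != a) \int[P]_w h i (X i w).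
under eq_integral do rewrite (bigD1 a) //= mulrC EFinM.
transitivity (c%:E * \int[P]_w (h a (X a w))%:E)%E; last first.
  by rewrite (bigD1 a) //= mulrC EFinM /Rintegral fineK //; exact: integrable_fin_num.
apply: (@ge0_integral_indic_ext _ _ _ _ _ P (X a) (X a) _ _
  (fun w => \prod_(i | i != a) h i (X i w)) c _ _ _ (fun x => (h a x)%:E)) => //.
- by move=> w; exact: prodr_ge0.
- move=> B mB.
  pose h' i := if i == a then \1_B else h i.
  have mi : measurable_fun setT (\1_B : R -> R) by exact: measurable_indic.
  have iB : P.-integrable setT (fun w => (\1_B (X a w))%:E).
    apply: (@le_integrable _ _ _ _ _ measurableT _ (cst 1%:E)).
    + by apply/measurable_EFinP; exact: (measurableT_comp mi).
    + move=> w _; rewrite indicE /=; case: (_ \in _) => /=; rewrite lee_fin ?normr1 ?normr0 //.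
    + exact: finite_measure_integrable_cst.
  have H : (\int[P]_w (\prod_i h' i (X i w))%:E = (\prod_i \int[P]_w h' i (X i w))%:E)%E.
    apply: IH => i; rewrite /h'.
    + by case: eqP.
    + by case: eqP => // _ x; rewrite indicE.
    + by case: eqP => [->|].
    + move=> is_; case: eqP => [_|/eqP ia]; first by exists B.
      by apply: hs; rewrite in_cons negb_or ia.
  have E1 w : \prod_i h' i (X i w) = \1_B (X a w) * \prod_(i | i != a) h i (X i w).
    rewrite (bigD1 a) //= /h' eqxx; congr (_ * _).
    by apply: eq_bigr => i /negbTE ->.
  have E2 : \prod_i \int[P]_w h' i (X i w) = (\int[P]_w \1_B (X a w)) * c.
    rewrite (bigD1 a) //= /h' eqxx; congr (_ * _).
    by apply: eq_bigr => i /negbTE ->.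
  under eq_integral do rewrite -EFinM mulrC -E1.
  rewrite H E2 mulrC EFinM /Rintegral fineK //; exact: integrable_fin_num.
- exact/measurable_EFinP.
- by move=> x; rewrite lee_fin.
Qed.

End IndicatorProduct.

Section SignedProduct.
Context d (T : measurableType d) (R : realType) (P : probability T R).
Context (I : finType) (X : I -> {RV P >-> R}).
Hypothesis indep : mutually_independent X.
Implicit Types h : I -> R -> R.

(** A function [f] of arbitrary sign is the difference of the non-negative
    functions [`|f| + f] and [`|f|]; the coordinates are treated one at a time, and
    [s] lists those whose sign is free. *)
Lemma indep_prod_integrable h :
  (forall i, measurable_fun setT (h i)) ->
  (forall i, P.-integrable setT (fun w => (h i (X i w))%:E)) ->
  P.-integrable setT (fun w => (\prod_i h i (X i w))%:E).
Proof.
move=> mh ih; apply/integrableP; split.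
  apply/measurable_EFinP; apply: measurable_prod => i _.
  by apply: measurableT_comp.
pose h' i x := `|h i x|.
under eq_integral do rewrite abse_EFin normr_prod.
rewrite (@indep_prod_ge0 _ _ _ _ _ X indep (enum I) h') ?ltry //.
- by move=> i; apply: measurableT_comp.
- by move=> i x; exact: normr_ge0.
- move=> i; have := integrable_abse (ih i); apply: eq_integrable => // w _.
- by move=> i; rewrite mem_enum.
Qed.

Lemma indep_prod h :
  (forall i, measurable_fun setT (h i)) ->
  (forall i, P.-integrable setT (fun w => (h i (X i w))%:E)) ->
  \int[P]_w (\prod_i h i (X i w)) = \prod_i \int[P]_w h i (X i w).
Proof.
suff H (s : seq I) : forall h, (forall i, measurable_fun setT (h i)) ->
    (forall i, P.-integrable setT (fun w => (h i (X i w))%:E)) ->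
    (forall i, i \notin s -> forall x, 0 <= h i x) ->
    \int[P]_w (\prod_i h i (X i w)) = \prod_i \int[P]_w h i (X i w).
  by move=> mh ih; apply: (H (enum I)) => // i; rewrite mem_enum.
elim: s => [|a s IH] {}h mh ih h0.
  rewrite {1}/Rintegral (@indep_prod_ge0 _ _ _ _ _ X indep (enum I)) //.
  - by move=> i; exact: h0.
  - by move=> i; rewrite mem_enum.
pose upd (f : R -> R) i := if i == a then f else h i.
pose f1 x := `|h a x| + h a x; pose f2 x := `|h a x|.
have iN : P.-integrable setT (fun w => (f2 (X a w))%:E).
  by have := integrable_abse (ih a); apply: eq_integrable.
have iS : P.-integrable setT (fun w => (f1 (X a w))%:E).
  by have := integrableD measurableT iN (ih a); apply: eq_integrable.
have m2 : measurable_fun setT f2 by apply: measurableT_comp.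
have m1 : measurable_fun setT f1 by apply: measurable_funD.
have mu f : measurable_fun setT f -> forall i, measurable_fun setT (upd f i).
  by move=> mf i; rewrite /upd; case: eqP.
have iu (f : R -> R) : P.-integrable setT (fun w => (f (X a w))%:E) ->
    forall i, P.-integrable setT (fun w => (upd f i (X i w))%:E).
  by move=> fi i; rewrite /upd; case: eqP => [->|].
have pu (f : R -> R) : (forall x, 0 <= f x) ->
    forall i, i \notin s -> forall x, 0 <= upd f i x.
  move=> f0 i is_ x; rewrite /upd; case: eqP => // /eqP ia.
  by apply: h0; rewrite in_cons negb_or ia.
have E1 w : \prod_i h i (X i w) =
    \prod_i upd f1 i (X i w) - \prod_i upd f2 i (X i w).
  have D f : \prod_i upd f i (X i w) = f (X a w) * \prod_(i | i != a) h i (X i w).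
    rewrite (bigD1 a) //= /upd eqxx; congr (_ * _).
    by apply: eq_bigr => i /negbTE ->.
  by rewrite !D (bigD1 a) //= /f1 /f2; ring.
transitivity (\int[P]_w (\prod_i upd f1 i (X i w) - \prod_i upd f2 i (X i w))).
  by apply: eq_Rintegral => w _; exact: E1.
rewrite RintegralB //; try by apply: indep_prod_integrable; [exact: mu|exact: iu].
rewrite !IH; [|exact: mu|exact: iu|apply: pu|exact: mu|exact: iu|apply: pu].
- have D f : \prod_i \int[P]_w upd f i (X i w) =
      \int[P]_w f (X a w) * \prod_(i | i != a) \int[P]_w h i (X i w).
    rewrite (bigD1 a) //= /upd eqxx; congr (_ * _).
    by apply: eq_bigr => i /negbTE ->.
  rewrite !D [RHS](bigD1 a) //= -mulrBl -RintegralB //; congr (_ * _).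
  by apply: eq_Rintegral => w _; rewrite /f1 /f2; ring.
- by move=> x; exact: normr_ge0.
- by move=> x; rewrite /f1; have := ler_norm (- h a x); rewrite normrN; lra.
Qed.

End SignedProduct.

(** * The expected trace as a sum over closed walks *)

Section Trace.
Context (R : comPzRingType) (n N : nat) (x : 'I_n -> 'I_N -> R).

Definition vertex : finType := ('I_n + 'I_N)%type.
Definition is_row (v : vertex) : bool := if v is inl _ then true else false.
(** The value 1 is a filler: a walk only crosses pairs made of a row and a column. *)
Definition entry (e : vertex * vertex) : R :=
  if e is (inl i, inr j) then x i j else 1.

Fixpoint path_sum (o : vertex) (L : nat) (u : vertex) : R :=
  if L is L'.+1 then
    \sum_(v | is_row v != is_row u) entry (edge is_row u v) * path_sum o L' v
  else (u == o)%:R.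

Lemma path_sum2 o L i :
  path_sum o L.+2 (inl i) = \sum_k (\sum_j x i j * x k j) * path_sum o L (inl k).
Proof.
rewrite /= big_sumType /= big_pred0 // add0r.
rewrite (eq_bigr (fun j => \sum_k x i j * (x k j * path_sum o L (inl k)))); last first.
  move=> j _; rewrite big_sumType /= [X in _ + X]big_pred0 // addr0.
  by rewrite /edge /= mulr_sumr.
rewrite exchange_big /=; apply: eq_bigr => k _.
by rewrite mulr_suml; apply: eq_bigr => j _; rewrite mulrA.
Qed.

Lemma gram_expr_path_sum p i o :
  let A := (\matrix_(i, j) x i j) *m (\matrix_(i, j) x i j)^T in
  (A ^+ p) i o = path_sum (inl o) p.*2 (inl i).
Proof.
move=> A; elim: p i => [|p IH] i; first by rewrite expr0 mxE.
rewrite doubleS path_sum2 exprS mxE; apply: eq_bigr => k _.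
rewrite IH; congr (_ * _); rewrite mxE.
by apply: eq_bigr => j _; rewrite !mxE.
Qed.

Lemma card_rows : #|[pred v | is_row v]| = n.
Proof.
rewrite -sum1_card big_sumType /= [X in (_ + X)%N]big_pred0 // addn0.
by rewrite sum1_card card_ord.
Qed.

Lemma card_cols : #|[pred v | ~~ is_row v]| = N.
Proof.
rewrite -sum1_card big_sumType /= [X in (X + _)%N]big_pred0 // add0n.
by rewrite sum1_card card_ord.
Qed.

Lemma trace_scale_expr (a : R) (A : 'M[R]_n) p :
  \tr ((a *: A) ^+ p) = a ^+ p * \tr (A ^+ p).
Proof.
suff -> : (a *: A) ^+ p = a ^+ p *: A ^+ p by rewrite mxtraceZ.
elim: p => [|p IH]; first by rewrite !expr0 scale1r.
by rewrite !exprS IH -[LHS]/((a *: A) *m (a ^+ p *: A ^+ p))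
  -scalemxAl -scalemxAr scalerA.
Qed.

End Trace.

Section WalkSupport.
Context {R : realFieldType} {n N : nat}.
Notation vertex := (vertex n N).

Definition crossed (q : vertex * vertex -> nat) : Prop :=
  forall e, (0 < q e)%N -> is_row e.1 /\ ~~ is_row e.2.

Lemma crossed_add_at q u v : is_row v != is_row u -> crossed q ->
  crossed (add_at q (edge (@is_row n N) u v)).
Proof.
move=> uv cq e; rewrite /add_at; case: eqP => [-> _|_]; last by rewrite addn0; exact: cq.
by rewrite /edge; case: u uv => u; case: v => v.
Qed.

Lemma eq_walk_sum_crossed o (f g : (vertex * vertex -> nat) -> {set vertex} -> R) L u q S :
  crossed q -> (forall q' S', crossed q' -> f q' S' = g q' S') ->
  walk_sum (@is_row n N) o f L u q S = walk_sum (@is_row n N) o g L u q S.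
Proof.
move=> cq fg; elim: L u q S cq => [|L IH] u q S cq /=; first by rewrite fg.
by apply: eq_bigr => v uv; apply: IH; exact: crossed_add_at.
Qed.

(** Relates the products over all pairs of vertices, which index the crossings of a
    walk, to the products over the entries of the matrix. *)
Lemma prod_crossed (q : vertex * vertex -> nat) (F : vertex * vertex -> nat -> R) :
  (forall e, F e 0%N = 1) -> crossed q ->
  \prod_e F e (q e) =
  \prod_(ij : 'I_n * 'I_N) F (inl ij.1, inr ij.2) (q (inl ij.1, inr ij.2)).
Proof.
move=> F0 cq.
have z u v : ~~ (is_row u && ~~ is_row v) -> F (u, v) (q (u, v)) = 1.
  move=> uv; case: (posnP (q (u, v))) => [->//|/cq /= [u1 v1]].
  by rewrite u1 v1 in uv.
rewrite -(pair_bigA _ (fun i j => F (inl i, inr j) (q (inl i, inr j)))) /=.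
rewrite (eq_bigr (fun e => F (e.1, e.2) (q (e.1, e.2)))); last by case.
rewrite -(pair_bigA _ (fun u v => F (u, v) (q (u, v)))) /=.
rewrite big_sumType /= [X in _ * X]big1 ?mulr1; last first.
  by move=> i _; rewrite big1 // => v _; apply: z.
by apply: eq_bigr => i _; rewrite big_sumType /= big1 ?mul1r // => k _; apply: z.
Qed.

End WalkSupport.

Lemma integrable_sum_EFin d (T : measurableType d) (R : realType)
    (mu : {measure set T -> \bar R}) (I : Type) (s : seq I) (Q : pred I)
    (f : I -> T -> R) :
  (forall i, Q i -> mu.-integrable setT (fun w => (f i w)%:E)) ->
  mu.-integrable setT (fun w => (\sum_(i <- s | Q i) f i w)%:E).
Proof.
move=> fi; under eq_fun do rewrite -sumEFin.
exact: integrable_sum.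
Qed.

Lemma Rintegral_sum d (T : measurableType d) (R : realType)
    (mu : {measure set T -> \bar R}) (I : Type) (s : seq I) (Q : pred I)
    (f : I -> T -> R) :
  (forall i, Q i -> mu.-integrable setT (fun w => (f i w)%:E)) ->
  \int[mu]_w (\sum_(i <- s | Q i) f i w) = \sum_(i <- s | Q i) \int[mu]_w f i w.
Proof.
move=> fi; elim: s => [|a s IH].
  under eq_Rintegral do rewrite big_nil.
  by rewrite big_nil Rintegral_cst // mul0r.
under eq_Rintegral do rewrite big_cons.
rewrite big_cons; case: ifP => Qa; last exact: IH.
rewrite RintegralD //; first by rewrite IH.
  exact: fi.
exact: integrable_sum_EFin.
Qed.

Section ExpectedTrace.
Context d (T : measurableType d) (R : realType) (P : probability T R).
Context (n N : nat) (X : 'I_n -> 'I_N -> {RV P >-> R}).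
Hypothesis indep : mutually_independent (fun ij : 'I_n * 'I_N => X ij.1 ij.2).
Hypothesis intX : forall i j k, P.-integrable setT (fun w => (X i j w ^+ k)%:E).
Notation vertex := (vertex n N).

(** Pairs which are no edges are given the moments of a random sign, so that all
    pairs satisfy the assumptions made on the moments of an entry. *)
Definition moment (e : vertex * vertex) (k : nat) : R :=
  if e is (inl i, inr j) then \int[P]_w (X i j w ^+ k) else (~~ odd k)%:R.

Let mono (q : vertex * vertex -> nat) w : R :=
  \prod_(ij : 'I_n * 'I_N) X ij.1 ij.2 w ^+ q (inl ij.1, inr ij.2).

Let monoE (q : vertex * vertex -> nat) (S : {set vertex}) : R :=
  \prod_(ij : 'I_n * 'I_N) moment (inl ij.1, inr ij.2) (q (inl ij.1, inr ij.2)).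

Let path w := path_sum (fun i j => X i j w).

Let mono_add_at q u v w : is_row v != is_row u ->
  entry (fun i j => X i j w) (edge (@is_row n N) u v) * mono q w =
  mono (add_at q (edge (@is_row n N) u v)) w.
Proof.
have H i j : X i j w * mono q w = mono (add_at q (inl i, inr j)) w.
  rewrite /mono (bigD1 (i, j)) //= [RHS](bigD1 (i, j)) //= /add_at eqxx addn1 exprS -mulrA.
  congr (_ * (_ * _)); apply: eq_bigr => -[i' j'] ne /=.
  case: eqP => [[ei ej]|_]; last by rewrite addn0.
  by rewrite ei ej eqxx in ne.
by rewrite /edge; case: u => u; case: v => v //= _; exact: H.
Qed.

Let mono_int q : P.-integrable setT (fun w => (mono q w)%:E) /\
  \int[P]_w mono q w = monoE q finset.set0.
Proof.
pose h (ij : 'I_n * 'I_N) (x : R) := x ^+ q (inl ij.1, inr ij.2).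
have mh ij : measurable_fun setT (h ij) by exact: measurable_funX.
split; first exact: (indep_prod_integrable indep mh (fun ij => intX _ _ _)).
exact: (indep_prod indep mh (fun ij => intX _ _ _)).
Qed.

(** The monomial [mono q] carries the entries crossed so far; independence is used
    once, when the walk is over and the whole product is a monomial. *)
Lemma path_sum_expectation (o u : vertex) (L : nat) q :
  P.-integrable setT (fun w => (path w o L u * mono q w)%:E) /\
  (forall S, \int[P]_w (path w o L u * mono q w) =
    walk_sum (@is_row n N) o monoE L u q S).
Proof.
elim: L u q => [|L IH] u q.
  rewrite /path /=; case: eqP => _.
    split=> [|S]; [under eq_fun do rewrite mul1r|under eq_Rintegral do rewrite mul1r].
      exact: (mono_int q).1.
    exact: (mono_int q).2.
  split=> [|S]; [under eq_fun do rewrite mul0r|under eq_Rintegral do rewrite mul0r].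
    exact: integrable0.
  by rewrite Rintegral_cst // mul0r.
have E w : path w o L.+1 u * mono q w =
   \sum_(v | is_row v != is_row u) path w o L v * mono (add_at q (edge (@is_row n N) u v)) w.
  rewrite /path /= mulr_suml; apply: eq_bigr => v uv.
  by rewrite -mono_add_at // mulrA [X in X * _]mulrC -!mulrA; congr (_ * _).
split=> [|S].
  under eq_fun do rewrite E.
  by apply: integrable_sum_EFin => v uv; exact: (IH _ _).1.
under eq_Rintegral do rewrite E.
rewrite [walk_sum _ _ _ _ _ _ _]/=.
rewrite Rintegral_sum; last by move=> v _; exact: (IH _ _).1.
by apply: eq_bigr => v _; exact: (IH _ _).2.
Qed.

Lemma expectation_trace p :
  ('E_P[fun w => \tr (sample_covariance X w ^+ p)] =
   (N%:R ^- p * \sum_(o | @is_row n N o)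
      walk_sum (@is_row n N) o (fun q _ => \prod_e moment e (q e)) p.*2 o (fun=> 0%N)
        [set o]%SET)%:E)%E.
Proof.
have mono0 w : mono (fun=> 0%N) w = 1 by rewrite /mono big1.
have int_path o u L : P.-integrable setT (fun w => (path w o L u)%:E).
  have := (path_sum_expectation o u L (fun=> 0%N)).1.
  by under eq_fun do rewrite mono0 mulr1.
have trE w : \tr (sample_covariance X w ^+ p) =
    N%:R ^- p * \sum_i path w (inl i) p.*2 (inl i).
  rewrite /sample_covariance trace_scale_expr exprVn; congr (_ * _).
  by apply: eq_bigr => i _; rewrite gram_expr_path_sum.
rewrite unlock; under eq_integral do rewrite trE.
have isum : P.-integrable setT (fun w => (\sum_i path w (inl i) p.*2 (inl i))%:E).
  by apply: integrable_sum_EFin => i _; exact: int_path.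
rewrite -[LHS]fineK; last first.
  apply: integrable_fin_num => //.
  by under eq_fun do rewrite EFinM; exact: integrableZl.
congr (_%:E).
transitivity (\int[P]_w (N%:R ^- p * \sum_i path w (inl i) p.*2 (inl i))); first by [].
rewrite RintegralZl // Rintegral_sum; last by move=> i _; exact: int_path.
congr (_ * _); rewrite big_sumType /= [X in _ = _ + X]big_pred0 // addr0.
apply: eq_bigr => i _.
have := (path_sum_expectation (inl i) (inl i) p.*2 (fun=> 0%N)).2 [set inl i]%SET.
under eq_Rintegral do rewrite mono0 mulr1.
move=> ->; apply: eq_walk_sum_crossed => // q S cq.
rewrite /monoE (@prod_crossed _ _ _ q moment) //.
case=> -[a|a] [b|b] //=.
under eq_Rintegral do rewrite expr0.
rewrite Rintegral_cst // mul1r.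
exact: (congr1 fine (probability_setT P)).
Qed.

End ExpectedTrace.

(** * Moments of symmetric subgaussian variables *)

Section Subgaussian.
Context d (T : measurableType d) (R : realType) (P : probability T R).
Context (X : {RV P >-> R}).

Let mX k : measurable_fun setT (fun w => X w ^+ k).
Proof. by apply: measurable_funX. Qed.

(** The non-negative function [`|x ^ k| + x ^ k] has the same mean at [X] and at
    [- X], where its value is [`|x ^ k| - x ^ k]. *)
Lemma symmetric_odd_moment k : symmetric_law X -> odd k ->
  P.-integrable setT (fun w => (X w ^+ k)%:E) -> \int[P]_w (X w ^+ k) = 0.
Proof.
move=> symX ok iX.
pose f (x : R) : \bar R := (`|x ^+ k| + x ^+ k)%:E.
have mN : measurable_fun setT (fun w => - X w) by exact: measurableT_comp.
have iN : P.-integrable setT (fun w => (`|X w ^+ k|)%:E).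
  by have := integrable_abse iX; apply: eq_integrable.
have H : (\int[P]_w (1%:E * f (X w)) = 1%:E * \int[P]_w f (- X w)%R)%E.
  apply: (@ge0_integral_indic_ext _ _ _ _ _ P X (fun w => - X w) _ mN (cst 1) 1).
  - exact: measurable_funPT.
  - exact: measurable_cst.
  - by [].
  - move=> B mB; rewrite mul1e; under eq_integral do rewrite mul1e.
    transitivity (P (X @^-1` B)).
      transitivity (\int[P]_w (\1_(X @^-1` B) w)%:E)%E; first by [].
      by rewrite integral_indic ?setIT //; apply: measurable_funPTI.
    rewrite symX //; symmetry.
    transitivity (\int[P]_w (\1_((fun w => (- X w)%R) @^-1` B) w)%:E)%E; first by [].
    by rewrite integral_indic ?setIT // -[X in measurable X]setTI; exact: mN.
  - apply/measurable_EFinP; apply: measurable_funD; last exact: measurable_funX.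
    by apply: measurableT_comp => //; exact: measurable_funX.
  - by move=> x; rewrite lee_fin; have := ler_norm (- x ^+ k); rewrite normrN; lra.
move: H; rewrite mul1e; under eq_integral do rewrite mul1e.
move=> /(congr1 fine).
have -> : fine (\int[P]_w f (X w))%E = \int[P]_w (`|X w ^+ k| + X w ^+ k) by [].
have -> : fine (\int[P]_w f (- X w)%R)%E = \int[P]_w (`|X w ^+ k| - X w ^+ k).
  apply: eq_Rintegral => w _.
  by rewrite exprNn -signr_odd ok expr1 mulN1r normrN.
rewrite RintegralD // RintegralB //; lra.
Qed.

Variable C : R.
Hypothesis C_gt0 : 0 < C.
Hypothesis X_sub : forall k, (0 < k)%N ->
  ('E_P[fun w => (X w ^+ (2 * k))%R] <= ((C * k%:R) ^+ k)%R%:E)%E.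

Let iX2 k : P.-integrable setT (fun w => (X w ^+ (2 * k))%:E).
Proof.
case: k => [|k].
  under eq_fun do rewrite expr0; exact: finite_measure_integrable_cst.
apply/integrableP; split; first by apply/measurable_EFinP; exact: mX.
have absE w : (`|(X w ^+ (2 * k.+1))%:E| = (X w ^+ (2 * k.+1))%:E)%E.
  by rewrite gee0_abs // lee_fin exprM exprn_ge0 // sqr_ge0.
under eq_integral do rewrite absE.
by have := @X_sub k.+1 isT; rewrite unlock => /le_lt_trans; apply; exact: ltry.
Qed.

(** Odd powers are dominated through [`|x| ^ k <= 1 + x ^ (2k)]. *)
Lemma subgaussian_integrable k : P.-integrable setT (fun w => (X w ^+ k)%:E).
Proof.
have i1 := integrableD measurableT (finite_measure_integrable_cst P 1 measurableT) (iX2 k).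
apply: (le_integrable measurableT _ _ i1); first by apply/measurable_EFinP; exact: mX.
move=> w _; rewrite /= lee_fin normrX mulnC exprM.
set y := `|X w| ^+ k; have -> : (X w ^+ k) ^+ 2 = y ^+ 2.
  by rewrite /y -normrX real_normK // num_real.
rewrite ger0_norm; last by rewrite addr_ge0 // sqr_ge0.
have : 0 <= (y - 1) ^+ 2 by rewrite sqr_ge0.
have : 0 <= y ^+ 2 by rewrite sqr_ge0.
rewrite sqrrB1 mulr2n; lra.
Qed.

Lemma subgaussian_moment k : (0 < k)%N ->
  \int[P]_w (X w ^+ (2 * k)) <= (C * k%:R) ^+ k.
Proof.
move=> k0; rewrite -lee_fin /Rintegral fineK; last exact: integrable_fin_num.
by have := X_sub k0; rewrite unlock.
Qed.

(** The exponent [k - 1] instead of [k] matters: with it an edge crossed twice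
    costs nothing, which preserves the main term. It is available for [k = 1] by
    unit variance and from [k = 2] on because [k <= 2 (k - 1)]. *)
Lemma subgaussian_moment_le_pairings K k :
  1 <= K -> (2 * C) ^+ 2 <= K -> \int[P]_w (X w ^+ 2) = 1 ->
  \int[P]_w (X w ^+ k.*2) <= K ^+ k.-1 * (pairings k.*2 0)%:R.
Proof.
move=> K1 CK var.
have K0 : 0 <= K by lra.
case: k => [|[|k]].
- under eq_Rintegral do rewrite expr0.
  rewrite Rintegral_cst // mul1r mul1r.
  by rewrite (_ : fine _ = 1) //; exact: (congr1 fine (probability_setT P)).
- by rewrite var mul1r.
have H j : (C * j%:R) ^+ j <= (2 * C) ^+ j * (pairings j.*2 0)%:R.
  rewrite !exprMn (mulrC (2 ^+ _)) -mulrA; apply: ler_wpM2l.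
    by rewrite exprn_ge0 // ltW.
  by rewrite -!natrX -natrM ler_nat pairings_even_ge.
rewrite -mul2n; apply: le_trans (@subgaussian_moment k.+2 isT) _.
apply: le_trans (H _) _; rewrite mul2n; apply: ler_wpM2r => //.
have [C1|C1] := lerP (2 * C) 1.
  apply: (@le_trans _ _ 1); last exact: exprn_ege1.
  by apply: exprn_ile1 => //; rewrite mulr_ge0 // ltW.
apply: (@le_trans _ _ ((2 * C) ^+ (2 * k.+1))).
  by apply: ler_weXn2l; [exact: ltW|lia].
by rewrite exprM; apply: lerXn2r; rewrite ?nnegrE ?sqr_ge0.
Qed.

End Subgaussian.

(** * The expected trace *)

Section FixedDimension.
Context d (T : measurableType d) (R : realType) (P : probability T R).
Context (n N : nat) (X : 'I_n -> 'I_N -> {RV P >-> R}) (C : R).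
Hypothesis indep : mutually_independent (fun ij : 'I_n * 'I_N => X ij.1 ij.2).
Hypothesis X_sym : forall i j, symmetric_law (X i j).
Hypothesis C_gt0 : 0 < C.
Hypothesis X_sub : forall i j k, (0 < k)%N ->
  ('E_P[fun w => (X i j w ^+ (2 * k))%R] <= ((C * k%:R) ^+ k)%R%:E)%E.
Hypothesis X_var : forall i j, ('E_P[fun w => (X i j w ^+ 2)%R] = 1)%E.

Lemma expectation_trace_asymp K p (m : R) :
  1 <= K -> (2 * C) ^+ 2 <= K -> 0 < m -> m <= n%:R -> m <= N%:R ->
  64 * K * p.+1%:R ^+ 2 <= m ->
  exists2 e : R, `|e| <= 64 * K * p.+1%:R ^+ 2 / m &
  ('E_P[fun w => \tr (sample_covariance X w ^+ p.+1)] =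
    (n%:R * mp_moment p.+1 (n%:R / N%:R) * (1 + e))%:E)%E.
Proof.
move=> K1 CK m0 mn mN Kpm.
have n0 : 0 < n%:R :> R by apply: lt_le_trans mn.
have N0 : 0 < N%:R :> R by apply: lt_le_trans mN.
have iX i j k : P.-integrable setT (fun w => (X i j w ^+ k)%:E).
  exact: (subgaussian_integrable (@X_sub i j)).
rewrite (expectation_trace indep iX).
have var i j : \int[P]_w (X i j w ^+ 2) = 1.
  by have := X_var i j; rewrite unlock => /(congr1 fine).
have m_odd e k : odd k -> moment X e k = 0.
  move=> ok; case: e => -[i|i] [j|j] /=; rewrite ?ok //.
  exact: (symmetric_odd_moment (X_sym i j) ok).
have m_ge0 e k : 0 <= moment X e k.
  have [ok|ek] := boolP (odd k); first by rewrite m_odd.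
  case: e => -[i|i] [j|j] //=; rewrite ?ek //.
  by apply: Rintegral_ge0 => w _; exact: exprn_even_ge0.
have m_0 e : moment X e 0 = 1.
  case: e => -[i|i] [j|j] //=.
  under eq_Rintegral do rewrite expr0.
  by rewrite Rintegral_cst // mul1r; exact: (congr1 fine (probability_setT P)).
have m_2 e : moment X e 2 = 1 by case: e => -[i|i] [j|j] //=; exact: var.
have K_ge0 : 0 <= K by lra.
have m_le e k : moment X e k.*2 <= K ^+ k.-1 * (pairings k.*2 0)%:R.
  have nb : (~~ odd k.*2)%:R <= K ^+ k.-1 * (pairings k.*2 0)%:R :> R.
    rewrite odd_double; apply: mulr_ege1; first exact: exprn_ege1.
    rewrite ler1n; have := pairings_even_ge k; case: (pairings _ _) => //.
    by rewrite muln0 leqn0 expn_eq0; case: (k).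
  case: e => -[i|i] [j|j]; try exact: nb.
  exact: (subgaussian_moment_le_pairings C_gt0 (@X_sub i j) k K1 CK (var i j)).
have := @walk_sum_asymp R (vertex n N) (@is_row n N) (moment X) K K1 m_ge0 m_odd m_0 m_2 m_le p.+1 m isT m0.
rewrite card_rows card_cols => /(_ mn mN Kpm).
set S := \sum_(o | _) _; set D := dyck _ _ _ _.
have g0 : 0 < n%:R / N%:R :> R by rewrite divr_gt0.
have DE : D = N%:R ^+ p.+1 * mp_moment p.+1 (n%:R / N%:R).
  rewrite (mp_moment_dyck g0) -dyckZ; apply: dyck_eq => r k.
  rewrite add0n => /double_inj <-; rewrite exprD expr_div_n; field.
  by rewrite expf_eq0 gt_eqF ?andbF.
move=> H.
have b0 := mp_moment_gt0 g0 p; set b := mp_moment _ _ in b0 DE *.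
have W0 : 0 < n%:R * D by rewrite DE !mulr_gt0 // exprn_gt0.
exists (S / (n%:R * D) - 1).
  have -> : S / (n%:R * D) - 1 = (S - n%:R * D) / (n%:R * D).
    by rewrite mulrBl divff // gt_eqF.
  by rewrite normrM normfV (gtr0_norm W0) ler_pdivrMr.
congr (_%:E); rewrite addrC subrK DE; move: (N%:R ^+ p.+1) (exprn_gt0 p.+1 N0) => M M0.
by field; rewrite !gt_eqF.
Qed.

End FixedDimension.

Theorem theorem4 (R : realType) (N p : nat -> nat)
    (d : nat -> measure_display) (T : forall n, measurableType (d n))
    (P : forall n, probability (T n) R)
    (X : forall n, 'I_n -> 'I_(N n) -> {RV (P n) >-> R})
    (C gamma : R)
    (X_iid : forall n, iid (fun ij : 'I_n * 'I_(N n) => X n ij.1 ij.2))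
    (X_sym : forall n i j, symmetric_law (X n i j))
    (C_gt0 : 0 < C)
    (X_subgaussian : forall n i j (k : nat), (0 < k)%N ->
       ('E_(P n)[fun w => (X n i j w ^+ (2 * k))%R] <= ((C * k%:R) ^+ k)%R%:E)%E)
    (X_var : forall n i j, ('E_(P n)[fun w => (X n i j w ^+ 2)%R] = 1)%E)
    (gamma_gt0 : 0 < gamma)
    (ratio_cvg : (fun n => n%:R / (N n)%:R : R) @ \oo --> gamma)
    (p_gt0 : forall n, (0 < p n)%N)
    (p_small : (fun n => (p n)%:R : R^o) =o_\oo (fun n => Num.sqrt n%:R : R^o)) :
  exists eps : nat -> R^o,
    eps =O_\oo (fun n => (p n)%:R ^+ 2 / n%:R : R^o) /\
    \forall n \near \oo,
      ('E_(P n)[fun w => (\tr (sample_covariance (X n) w ^+ p n))%R] =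
        (n%:R * mp_moment (p n) (n%:R / (N n)%:R) * (1 + eps n))%R%:E)%E.
Proof.
pose K := 1 + (2 * C) ^+ 2; pose a := Num.min 1 (2 * gamma)^-1.
have K1 : 1 <= K by rewrite lerDl sqr_ge0.
have CK : (2 * C) ^+ 2 <= K by rewrite lerDr.
have K0 : 0 < K by apply: lt_le_trans K1.
have a0 : 0 < a by rewrite lt_min ltr01 invr_gt0 mulr_gt0.
pose tr n := 'E_(P n)[fun w => (\tr (sample_covariance (X n) w ^+ p n))%R]%E.
pose lead n : R := n%:R * mp_moment (p n) (n%:R / (N n)%:R).
pose bound n : R := 64 * K * (p n)%:R ^+ 2 / (a * n%:R).
have near_bound : \forall n \near \oo, 0 < n%:R :> R /\ 0 < lead n /\
    exists2 e : R, `|e| <= bound n & (tr n = (lead n * (1 + e))%:E)%E.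
  (* This is where p = o(sqrt n) enters. *)
  have psq : \forall n \near \oo, 64 * K * (p n)%:R ^+ 2 <= a * n%:R.
    pose c := Num.sqrt (a / (64 * K)).
    have aK : 0 < a / (64 * K) by rewrite divr_gt0 // mulr_gt0.
    have c0 : 0 < c by rewrite sqrtr_gt0.
    move/eqoP: p_small => /(_ c c0); apply: filterS => n.
    rewrite !ger0_norm ?sqrtr_ge0 // => pn.
    have : (p n)%:R ^+ 2 <= (c * Num.sqrt n%:R) ^+ 2.
      by apply: lerXn2r; rewrite ?nnegrE // mulr_ge0 ?sqrtr_ge0.
    rewrite exprMn !sqr_sqrtr ?(ltW aK) // => pn2.
    have := ler_wpM2l (ltW (mulr_gt0 (ltr0Sn R 63) K0)) pn2.
    move/le_trans; apply; rewrite le_eqVlt; apply/orP; left; apply/eqP; field.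
    by rewrite gt_eqF.
  have ratio : \forall n \near \oo, n%:R / (N n)%:R < 2 * gamma.
    by apply: (cvgr_lt gamma) ratio_cvg _ _; rewrite mulr_natl mulr2n ltrDl.
  have ratio_gt0 : \forall n \near \oo, 0 < n%:R / (N n)%:R :> R.
    exact: (cvgr_gt gamma) ratio_cvg _ gamma_gt0.
  near=> n.
  have rn : n%:R / (N n)%:R < 2 * gamma by near: n.
  have r0 : 0 < n%:R / (N n)%:R :> R by near: n.
  have pn : 64 * K * (p n)%:R ^+ 2 <= a * n%:R by near: n.
  have n0 : 0 < n%:R :> R.
    rewrite ltr0n lt0n; apply: contraTneq r0 => ->.
    by rewrite mul0r ltxx.
  have N0 : 0 < (N n)%:R :> R.
    rewrite ltr0n lt0n; apply: contraTneq r0 => ->.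
    by rewrite invr0 mulr0 ltxx.
  split=> //.
  (* Both dimensions are at least a n, by the choice of a and n / N < 2 gamma. *)
  have an : a * n%:R <= n%:R by rewrite ler_piMl // ge_min lexx.
  have aN : a * n%:R <= (N n)%:R.
    apply: (@le_trans _ _ ((2 * gamma)^-1 * n%:R)).
      by apply: ler_wpM2r => //; rewrite ge_min lexx orbT.
    rewrite mulrC ler_pdivrMr ?mulr_gt0 // mulrC -ler_pdivrMr //; exact: ltW.
  split; first by rewrite /lead mulr_gt0 // -(prednK (p_gt0 n)) mp_moment_gt0.
  have := p_gt0 n; rewrite /tr /lead /bound; move: pn; case: (p n) => // q pn _.
  apply: (@expectation_trace_asymp _ _ _ (P n) n (N n) (X n) C
    (X_iid n).1 (X_sym n) C_gt0 (X_subgaussian n) (X_var n) K q (a * n%:R)) => //.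
  exact: mulr_gt0.
pose eps n : R^o := fine (tr n) / lead n - 1.
exists eps; split.
  apply/eqO_exP; exists (64 * K / a); first by rewrite divr_gt0 // mulr_gt0.
  apply: filterS near_bound => n [n0 [l0 [e en trn]]].
  have -> : eps n = e by rewrite /eps trn /= mulrAC divff ?gt_eqF // mul1r addrC addKr.
  rewrite [X in _ <= _ * X]ger0_norm; last by rewrite divr_ge0 ?sqr_ge0 // ltW.
  apply: le_trans en _; rewrite /bound le_eqVlt; apply/orP; left; apply/eqP; field.
  by rewrite !gt_eqF.
apply: filterS near_bound => n [n0 [l0 [e _ trn]]].
rewrite -/(tr n) -/(lead n) /eps addrC subrK mulrCA divff ?gt_eqF // mulr1.
by rewrite trn.
Unshelve. all: by end_near.
Qed.
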